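(* Let $\mathcal X,\mathcal Z$ be complex Hilbert spaces, let $E\in L(\mathcal X,\mathcal Z)$ and let $A\colon\mathcal D(A)\subseteq\mathcal X\to\mathcal Z$ be closed and densely defined. Assume that $(E,A)$ has a Weierstraß form $$(E,A)\sim\left(\begin{bmatrix}I_{\mathcal Y^1}&0\\0&N\end{bmatrix},\begin{bmatrix}A_1&0\\0&I_{\mathcal Y^2}\end{bmatrix}\right).$$ If $A_1$ is densely defined and $(E,A)$ has a complex resolvent index $p=p_{\mathrm{c,res}}^{(E,A)}$, then $A_1$ generates a $(p+2)$-times integrated semigroup.
   Context: $L(\mathcal X,\mathcal Z)$ denotes bounded linear operators; $\mathbb N=\{0,1,2,\dots\}$; $\mathbb C_{\mathrm{Re}>\omega}=\{\lambda\in\mathbb C:\operatorname{Re}\lambda>\omega\}$; $\rho(E,A)=\{\lambda\in\mathbb C:(\lambda E-A)^{-1}\in L(\mathcal Z,\mathcal X)\}$. Complex resolvent index: the smallest $p=p_{\mathrm{c,res}}^{(E,A)}\in\mathbb N$ such that there exist $\omega\in\mathbb R$, $C>0$ with $\mathbb C_{\mathrm{Re}>\omega}\subseteq\rho(E,A)$ and $\|(\lambda E-A)^{-1}\|\le C|\lambda|^{p-1}$ for all $\lambda\in\mathbb C_{\mathrm{Re}>\omega}$. Equivalence: $(E,A)\sim(\tilde E,\tilde A)$ (the latter on Hilbert spaces $\tilde{\mathcal X},\tilde{\mathcal Z}$) if there are bounded isomorphisms $P\colon\mathcal X\to\tilde{\mathcal X}$, $Q\colon\mathcal Z\to\tilde{\mathcal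 Z}$ with $E=Q^{-1}\tilde EP$ and $A=Q^{-1}\tilde AP$ (including $\mathcal D(A)=P^{-1}\mathcal D(\tilde A)$). Weierstraß form: $(E,A)$ has a Weierstraß form if, for some Hilbert space $\mathcal Y=\mathcal Y^1\oplus\mathcal Y^2$, the displayed equivalence holds, where $N\colon\mathcal Y^2\to\mathcal Y^2$ is nilpotent, $A_1\colon\mathcal D(A_1)\subseteq\mathcal Y^1\to\mathcal Y^1$ is linear, and $I_{\mathcal Y^i}$ is the identity on $\mathcal Y^i$. Integrated semigroup: for an integer $n\ge1$, a linear operator $B$ on a Banach space $\mathcal W$ is the generator of an $(n-1)$-times integrated semigroup $(S(t))_{t\ge0}$ if there exist $M,\omega>0$ and a strongly continuous family $(S(t))_{t\ge0}$ in $L(\mathcal W)$ with $\|S(t)\|\le Me^{\omega t}$ for all $t\ge0$, $(\omega,\infty)\subseteq\rho(B)$ and $(\lambda I-B)^{-1}w=\lambda^{n-1}\int_0^\infty e^{-\lambda t}S(t)w\,dt$ for all $w\in\mathcal W$ and $\lambda>\omega$. *)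

(* Defs.v *)
From Stdlib Require Import Reals ZArith Lra.
From Coquelicot Require Import Coquelicot.

Set Implicit Arguments.
Unset Strict Implicit.
Unset Printing Implicit Defensive.

Local Open Scope R_scope.

(* Completeness is inherited from [CompleteNormedModule]; positivity and
   definiteness of the inner product follow from [inner_norm] and the norm
   axioms. *)
Record HilbertSpace : Type := {
  hilbert_carrier :> CompleteNormedModule C_AbsRing;
  inner : hilbert_carrier -> hilbert_carrier -> C;
  inner_plus_l : forall x y z, inner (plus x y) z = Cplus (inner x z) (inner y z);
  inner_scal_l : forall (a : C_AbsRing) x y, inner (scal a x) y = Cmult a (inner x y);
  inner_conj : forall x y, inner y x = Cconj (inner x y);
  inner_norm : forall x, inner x x = RtoC (norm x ^ 2)
}.

Definition prod_lim (U V : CompleteSpace) (F : (U * V -> Prop) -> Prop) : U * V :=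
  (lim (filtermap fst F), lim (filtermap snd F)).

Lemma prod_complete (U V : CompleteSpace) (F : (U * V -> Prop) -> Prop) :
  ProperFilter F -> cauchy F ->
  forall eps : posreal, F (ball (prod_lim F) eps).
Proof.
intros HF HC eps.
assert (H1 : F (fun z => ball (lim (filtermap fst F)) eps (fst z))).
{ apply (complete_cauchy (filtermap fst F)).
  - now apply filtermap_proper_filter.
  - intros e; destruct (HC e) as [z Hz]; exists (fst z).
    unfold filtermap; revert Hz; apply filter_imp; now intros y [Hy _]. }
assert (H2 : F (fun z => ball (lim (filtermap snd F)) eps (snd z))).
{ apply (complete_cauchy (filtermap snd F)).
  - now apply filtermap_proper_filter.
  - intros e; destruct (HC e) as [z Hz]; exists (snd z).
    unfold filtermap; revert Hz; apply filter_imp; now intros y [_ Hy]. }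
generalize (filter_and _ _ H1 H2); apply filter_imp.
intros z [Ha Hb]; now split.
Qed.

Lemma prod_close_lim (U V : CompleteSpace) (F1 F2 : (U * V -> Prop) -> Prop) :
  filter_le F1 F2 -> filter_le F2 F1 -> close (prod_lim F1) (prod_lim F2).
Proof.
intros H12 H21 eps; split; simpl.
- apply (CompleteSpace.ax2 _ (CompleteSpace.class U)); intros P; [apply H12 | apply H21].
- apply (CompleteSpace.ax2 _ (CompleteSpace.class V)); intros P; [apply H12 | apply H21].
Qed.

Definition prod_CompleteSpace_mixin (U V : CompleteSpace) :=
  CompleteSpace.Mixin (prod_UniformSpace U V) (@prod_lim U V)
    (@prod_complete U V) (@prod_close_lim U V).

(* The norm of [prod_NormedModule] is sqrt (|x1|^2 + |x2|^2), the Hilbert sum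
   norm. *)
Definition prod_CompleteNormedModule (K : AbsRing) (U V : CompleteNormedModule K) :
  CompleteNormedModule K :=
  CompleteNormedModule.Pack K (U * V)
    (CompleteNormedModule.Class K (U * V)
       (NormedModule.class K (prod_NormedModule K U V))
       (prod_CompleteSpace_mixin U V))
    (U * V).

Definition sum_inner (H1 H2 : HilbertSpace) (x y : prod_CompleteNormedModule H1 H2) : C :=
  Cplus (inner (fst x) (fst y)) (inner (snd x) (snd y)).

Lemma sum_inner_plus_l (H1 H2 : HilbertSpace) (x y z : prod_CompleteNormedModule H1 H2) :
  sum_inner (plus x y) z = Cplus (sum_inner x z) (sum_inner y z).
Proof.
unfold sum_inner; simpl; rewrite !inner_plus_l; ring.
Qed.

Lemma sum_inner_scal_l (H1 H2 : HilbertSpace) (a : C_AbsRing) (x y : prod_CompleteNormedModule H1 H2) :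
  sum_inner (scal a x) y = Cmult a (sum_inner x y).
Proof.
unfold sum_inner; simpl; rewrite !inner_scal_l; ring.
Qed.

Lemma sum_inner_conj (H1 H2 : HilbertSpace) (x y : prod_CompleteNormedModule H1 H2) :
  sum_inner y x = Cconj (sum_inner x y).
Proof.
unfold sum_inner; rewrite (inner_conj (fst x)), (inner_conj (snd x)).
unfold Cconj, Cplus; simpl; f_equal; ring.
Qed.

Lemma sum_inner_norm (H1 H2 : HilbertSpace) (x : prod_CompleteNormedModule H1 H2) :
  sum_inner x x = RtoC (norm x ^ 2).
Proof.
unfold sum_inner; rewrite !inner_norm, <- RtoC_plus; f_equal.
change (norm x) with (sqrt (norm (fst x) ^ 2 + norm (snd x) ^ 2)).
rewrite pow2_sqrt; [reflexivity |].
apply Rplus_le_le_0_compat; apply pow2_ge_0.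
Qed.

Definition hilbert_sum (H1 H2 : HilbertSpace) : HilbertSpace :=
  {| hilbert_carrier := prod_CompleteNormedModule H1 H2;
     inner := @sum_inner H1 H2;
     inner_plus_l := @sum_inner_plus_l H1 H2;
     inner_scal_l := @sum_inner_scal_l H1 H2;
     inner_conj := @sum_inner_conj H1 H2;
     inner_norm := @sum_inner_norm H1 H2 |}.

(* Restriction of scalars: Coquelicot only integrates functions with values in
   normed modules over R. *)
Definition real_scal (V : CompleteNormedModule C_AbsRing) (r : R) (x : V) : V :=
  scal (RtoC r : C_AbsRing) x.

Lemma real_scal_assoc (V : CompleteNormedModule C_AbsRing) (r s : R) (x : V) :
  real_scal r (real_scal s x) = real_scal (r * s) x.
Proof.
unfold real_scal; rewrite scal_assoc; f_equal; symmetry; apply RtoC_mult.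
Qed.

Lemma real_scal_one (V : CompleteNormedModule C_AbsRing) (x : V) : real_scal 1 x = x.
Proof. exact (scal_one x). Qed.

Lemma real_scal_distr_l (V : CompleteNormedModule C_AbsRing) (r : R) (x y : V) :
  real_scal r (plus x y) = plus (real_scal r x) (real_scal r y).
Proof. exact (scal_distr_l (RtoC r : C_AbsRing) x y). Qed.

Lemma real_scal_distr_r (V : CompleteNormedModule C_AbsRing) (r s : R) (x : V) :
  real_scal (r + s) x = plus (real_scal r x) (real_scal s x).
Proof.
unfold real_scal; rewrite RtoC_plus.
exact (scal_distr_r (RtoC r : C_AbsRing) (RtoC s : C_AbsRing) x).
Qed.

Definition real_ModuleSpace (V : CompleteNormedModule C_AbsRing) : ModuleSpace R_Ring :=
  ModuleSpace.Pack R_Ring V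
    (ModuleSpace.Class R_Ring V (AbelianGroup.class V)
       (ModuleSpace.Mixin R_Ring V (@real_scal V) (@real_scal_assoc V)
          (@real_scal_one V) (@real_scal_distr_l V) (@real_scal_distr_r V)))
    V.

Definition real_NormedModuleAux (V : CompleteNormedModule C_AbsRing) :
  NormedModuleAux R_AbsRing :=
  NormedModuleAux.Pack R_AbsRing V
    (NormedModuleAux.Class R_AbsRing V
       (ModuleSpace.class R_Ring (real_ModuleSpace V)) (UniformSpace.class V))
    V.

Lemma norm_real_scal (V : CompleteNormedModule C_AbsRing) (r : R) (x : V) :
  norm (real_scal r x) <= Rabs r * norm x.
Proof.
unfold real_scal; rewrite <- Cmod_R; exact (norm_scal (RtoC r : C_AbsRing) x).
Qed.

Definition real_NormedModule_mixin (V : CompleteNormedModule C_AbsRing) :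
  NormedModule.mixin_of R_AbsRing (real_NormedModuleAux V) :=
  NormedModule.Mixin R_AbsRing (real_NormedModuleAux V)
    (fun x : V => norm x) (@norm_factor C_AbsRing V)
    (fun x y : V => norm_triangle x y)
    (@norm_real_scal V)
    (fun (x y : V) eps => @norm_compat1 C_AbsRing V x y eps)
    (fun (x y : V) eps => @norm_compat2 C_AbsRing V x y eps)
    (fun x : V => @norm_eq_zero C_AbsRing V x).

Definition realification (V : CompleteNormedModule C_AbsRing) :
  CompleteNormedModule R_AbsRing :=
  CompleteNormedModule.Pack R_AbsRing V
    (CompleteNormedModule.Class R_AbsRing V
       (NormedModule.Class R_AbsRing V
          (NormedModuleAux.class R_AbsRing (real_NormedModuleAux V))
          (real_NormedModule_mixin V))
       (CompleteSpace.mixin _ (CompleteSpace.class V)))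
    V.

(* Coquelicot's [is_linear] includes boundedness. *)
Record bounded_op (U V : NormedModule C_AbsRing) : Type := {
  bop_fun :> U -> V;
  bop_linear : is_linear bop_fun
}.

Definition opnorm (U V : NormedModule C_AbsRing) (T : bounded_op U V) : Rbar :=
  Lub_Rbar (fun r => exists x : U, norm x <= 1 /\ r = norm (T x)).

Definition bop_id (U : NormedModule C_AbsRing) : bounded_op U U :=
  Build_bounded_op (@is_linear_id C_AbsRing U).

(* The values of [op_fun] outside [op_dom] are irrelevant. *)
Record operator (U V : NormedModule C_AbsRing) : Type := {
  op_dom : U -> Prop;
  op_fun :> U -> V;
  op_dom_zero : op_dom zero;
  op_dom_plus : forall x y, op_dom x -> op_dom y -> op_dom (plus x y);
  op_dom_scal : forall (a : C_AbsRing) x, op_dom x -> op_dom (scal a x);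
  op_plus : forall x y, op_dom x -> op_dom y ->
    op_fun (plus x y) = plus (op_fun x) (op_fun y);
  op_scal : forall (a : C_AbsRing) x, op_dom x -> op_fun (scal a x) = scal a (op_fun x)
}.

Definition densely_defined (U V : NormedModule C_AbsRing) (A : operator U V) : Prop :=
  forall (x : U) (eps : posreal), exists y : U, op_dom A y /\ norm (minus y x) < eps.

Definition closed_operator (U V : NormedModule C_AbsRing) (A : operator U V) : Prop :=
  closed (fun z : U * V => op_dom A (fst z) /\ snd z = A (fst z)).

Definition bop_operator (U V : NormedModule C_AbsRing) (T : bounded_op U V) : operator U V :=
  {| op_dom := fun _ => True;
     op_fun := T;
     op_dom_zero := I;
     op_dom_plus := fun _ _ _ _ => I;
     op_dom_scal := fun _ _ _ => I;
     op_plus := fun x y _ _ => linear_plus T (bop_linear T) x y;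
     op_scal := fun a x _ => linear_scal T (bop_linear T) a x |}.

Definition nilpotent (U : NormedModule C_AbsRing) (T : bounded_op U U) : Prop :=
  exists k : nat, forall x : U, Nat.iter k T x = zero.

Definition diag_fun (U1 U2 V1 V2 : Type) (f1 : U1 -> V1) (f2 : U2 -> V2) (x : U1 * U2) :
  V1 * V2 := (f1 (fst x), f2 (snd x)).

Lemma diag_is_linear (U1 U2 V1 V2 : HilbertSpace)
  (T1 : bounded_op U1 V1) (T2 : bounded_op U2 V2) :
  @is_linear C_AbsRing (hilbert_sum U1 U2) (hilbert_sum V1 V2) (diag_fun T1 T2).
Proof.
split.
- intros [x1 x2] [y1 y2]; unfold diag_fun; simpl.
  now rewrite (linear_plus _ (bop_linear T1)), (linear_plus _ (bop_linear T2)).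
- intros k [x1 x2]; unfold diag_fun; simpl.
  now rewrite (linear_scal _ (bop_linear T1)), (linear_scal _ (bop_linear T2)).
- destruct (linear_norm _ (bop_linear T1)) as [M1 [HM1 H1]].
  destruct (linear_norm _ (bop_linear T2)) as [M2 [HM2 H2]].
  exists (M1 + M2); split; [lra |].
  intros [x1 x2].
  change (sqrt (norm (T1 x1) ^ 2 + norm (T2 x2) ^ 2)
          <= (M1 + M2) * sqrt (norm x1 ^ 2 + norm x2 ^ 2)).
  specialize (H1 x1); specialize (H2 x2).
  pose proof (norm_ge_0 x1); pose proof (norm_ge_0 x2).
  pose proof (norm_ge_0 (T1 x1)); pose proof (norm_ge_0 (T2 x2)).
  rewrite <- (sqrt_pow2 (M1 + M2)), <- sqrt_mult by nra.
  apply sqrt_le_1_alt.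
  rewrite Rmult_plus_distr_l, <- !Rpow_mult_distr.
  apply Rplus_le_compat; apply pow_incr; nra.
Qed.

Definition diag_bop (U1 U2 V1 V2 : HilbertSpace)
  (T1 : bounded_op U1 V1) (T2 : bounded_op U2 V2) :
  bounded_op (hilbert_sum U1 U2) (hilbert_sum V1 V2) :=
  Build_bounded_op (diag_is_linear T1 T2).

Definition diag_op (U1 U2 V1 V2 : HilbertSpace)
  (A1 : operator U1 V1) (A2 : operator U2 V2) :
  operator (hilbert_sum U1 U2) (hilbert_sum V1 V2).
Proof.
refine (@Build_operator (hilbert_sum U1 U2) (hilbert_sum V1 V2)
  (fun x => op_dom A1 (fst x) /\ op_dom A2 (snd x)) (diag_fun A1 A2) _ _ _ _ _).
- split; apply op_dom_zero.
- intros x y [Hx1 Hx2] [Hy1 Hy2]; split; now apply op_dom_plus.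
- intros a x [Hx1 Hx2]; split; now apply op_dom_scal.
- intros x y [Hx1 Hx2] [Hy1 Hy2]; apply injective_projections.
  + exact (op_plus Hx1 Hy1).
  + exact (op_plus Hx2 Hy2).
- intros a x [Hx1 Hx2]; apply injective_projections.
  + exact (op_scal a Hx1).
  + exact (op_scal a Hx2).
Defined.

Lemma minus_plus_plus (G : AbelianGroup) (u v a b : G) :
  minus (plus u v) (plus a b) = plus (minus u a) (minus v b).
Proof.
unfold minus; rewrite opp_plus, <- !plus_assoc; f_equal.
rewrite !plus_assoc; f_equal; apply plus_comm.
Qed.

Lemma minus_scal_plus (K : Ring) (V : ModuleSpace K) (l : K) (u v a b : V) :
  minus (scal l (plus u v)) (plus a b) = plus (minus (scal l u) a) (minus (scal l v) b).
Proof.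
rewrite scal_distr_l; apply minus_plus_plus.
Qed.

Lemma minus_scal_scal (K : Ring) (V : ModuleSpace K) (l c : K) (u a : V) :
  mult l c = mult c l ->
  minus (scal l (scal c u)) (scal c a) = scal c (minus (scal l u) a).
Proof.
intros Hlc; unfold minus.
rewrite scal_assoc, Hlc, <- scal_assoc.
rewrite <- (scal_opp_r c a); symmetry; apply (scal_distr_l c).
Qed.

Definition pencil (X Z : NormedModule C_AbsRing) (E : bounded_op X Z) (A : operator X Z)
  (lambda : C) : operator X Z.
Proof.
refine (@Build_operator X Z (op_dom A)
  (fun x => minus (scal (lambda : C_AbsRing) (E x)) (A x)) _ _ _ _ _).
- apply op_dom_zero.
- apply op_dom_plus.
- apply op_dom_scal.
- intros x y Hx Hy.
  rewrite (linear_plus _ (bop_linear E)), (op_plus Hx Hy).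
  exact (minus_scal_plus (V := NormedModule.ModuleSpace C_AbsRing Z)
           (lambda : C_AbsRing) (E x) (E y) (A x) (A y)).
- intros a x Hx.
  rewrite (linear_scal _ (bop_linear E)), (op_scal a Hx).
  exact (minus_scal_scal (V := NormedModule.ModuleSpace C_AbsRing Z)
           (E x) (A x) (Cmult_comm lambda a)).
Defined.

Definition bounded_inverse (X Z : NormedModule C_AbsRing) (T : operator X Z)
  (S : bounded_op Z X) : Prop :=
  (forall z : Z, op_dom T (S z) /\ T (S z) = z) /\
  (forall x : X, op_dom T x -> S (T x) = x).

Definition resolvent_set (X Z : NormedModule C_AbsRing)
  (E : bounded_op X Z) (A : operator X Z) (lambda : C) : Prop :=
  exists S : bounded_op Z X, bounded_inverse (pencil E A lambda) S.

(* At lambda = 0 with p = 0 the bound uses Stdlib's value of 0^{-1}; the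
   predicate does not depend on it, since omega can always be taken >= 0. *)
Definition complex_resolvent_growth (X Z : NormedModule C_AbsRing)
  (E : bounded_op X Z) (A : operator X Z) (p : nat) : Prop :=
  exists omega K : R, 0 < K /\
    (forall lambda : C, omega < Re lambda -> resolvent_set E A lambda) /\
    (forall (lambda : C) (S : bounded_op Z X), omega < Re lambda ->
       bounded_inverse (pencil E A lambda) S ->
       Rbar_le (opnorm S) (K * powerRZ (Cmod lambda) (Z.of_nat p - 1))).

Definition is_complex_resolvent_index (X Z : NormedModule C_AbsRing)
  (E : bounded_op X Z) (A : operator X Z) (p : nat) : Prop :=
  complex_resolvent_growth E A p /\
  (forall q : nat, complex_resolvent_growth E A q -> (p <= q)%nat).

Definition inverse_bops (U V : NormedModule C_AbsRing)
  (P : bounded_op U V) (P' : bounded_op V U) : Prop :=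
  (forall x : U, P' (P x) = x) /\ (forall y : V, P (P' y) = y).

Definition pair_equiv (X Z X' Z' : HilbertSpace)
  (E : bounded_op X Z) (A : operator X Z)
  (E' : bounded_op X' Z') (A' : operator X' Z') : Prop :=
  exists (P : bounded_op X X') (Pinv : bounded_op X' X)
         (Q : bounded_op Z Z') (Qinv : bounded_op Z' Z),
    inverse_bops P Pinv /\ inverse_bops Q Qinv /\
    (forall x : X, E x = Qinv (E' (P x))) /\
    (forall x : X, op_dom A x <-> op_dom A' (P x)) /\
    (forall x : X, op_dom A x -> A x = Qinv (A' (P x))).

Definition weierstrass_form (X Z Y1 Y2 : HilbertSpace)
  (E : bounded_op X Z) (A : operator X Z)
  (A1 : operator Y1 Y1) (N : bounded_op Y2 Y2) : Prop :=
  nilpotent N /\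
  pair_equiv E A (diag_bop (bop_id Y1) N) (diag_op A1 (bop_operator (bop_id Y2))).

(* The literature's (n-1)-times with n >= 1 is k-times with k = n - 1. Values of
   S at negative times are irrelevant. *)
Definition generates_integrated_semigroup (W : CompleteNormedModule C_AbsRing)
  (k : nat) (B : operator W W) : Prop :=
  exists (M omega : R) (S : R -> bounded_op W W),
    0 < M /\ 0 < omega /\
    (forall w : W, continuous_on (fun t : R => 0 <= t) (fun t : R => S t w)) /\
    (forall t : R, 0 <= t -> Rbar_le (opnorm (S t)) (M * exp (omega * t))) /\
    (forall lambda : R, omega < lambda -> resolvent_set (bop_id W) B (RtoC lambda)) /\
    (forall (lambda : R) (Res : bounded_op W W), omega < lambda ->
       bounded_inverse (pencil (bop_id W) B (RtoC lambda)) Res ->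
       forall w : W, exists v : realification W,
         is_RInt_gen (fun t : R => scal (exp (- (lambda * t))) (S t w : realification W))
           (at_point 0) (Rbar_locally p_infty) v /\
         Res w = scal (lambda ^ k) v).

(* Main.v *)
Require Import Defs.
From Stdlib Require Import Reals.
From Coquelicot Require Import Coquelicot.
From Stdlib Require Import ZArith Lra Lia List IndefiniteDescription.

(* The Weierstrass form turns the bound on (z E - A)^{-1} into
   |R(z)| <= K |z|^{p-1} for the resolvent R(z) of A1 on a half-plane Re z >= a,
   so F(z) = R(z) w / z^{p+2} decays like |z|^{-3} and
     S(t) w = 1/(2 pi) int_{-oo}^{oo} e^{(b + i s) t} F(b + i s) ds    (b > a)
   converges absolutely; it is linear in w, Lipschitz in t and bounded by
   a multiple of e^{b t}.
   For lam > b, Phi(t) = int e^{(z - lam) t} F(z) / (lam - z) ds over z = b + i s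
   satisfies Phi' = - 2 pi e^{- lam t} S(t) w and Phi(t) -> 0, so the Laplace
   transform of S w at lam is Phi(0) / (2 pi).
   To evaluate Phi(0), the resolvent identity
   R(z) w = R(lam) w + (lam - z) R(z) R(lam) w splits F(z) / (lam - z) into
   z^{-(p+2)} R(z) R(lam) w, whose integral vanishes by Cauchy's theorem, and the
   explicit kernel z^{-(p+2)} / (lam - z) times R(lam) w, whose integral is
   2 pi lam^{-(p+2)} R(lam) w. *)

Set Implicit Arguments.
Unset Strict Implicit.
Unset Printing Implicit Defensive.

Local Open Scope R_scope.

(** * Linear combinations of vectors *)

(** The exponent p + 2 comes from counting powers of |z|. Decay |z|^{-2} suffices for the integral
    defining S(t) and for Cauchy's theorem. A difference quotient in t costs one more factor |z|, so
    the third power yields strong continuity of S for every vector at once. The second-order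
    remainder of Phi costs |z|^2 and is paid by the cube together with the decay 1/|z| of the kernel
    1/(lam - z). All limits are quantitative: integrands are dominated by K/(1 + s^2) with K
    explicit, improper integrals are limits over [-L, L], and differentiation under the integral
    sign rests on quadratic remainder bounds instead of dominated convergence. Cauchy's theorem is
    proved in the same way, by differentiating a line integral in its abscissa. The abscissas are
    ordered 1 <= a < b < lam. The bound 1 <= a gives 1/|z| <= 1 and b^2 + s^2 >= 1 + s^2; the gap a
    < b leaves room to differentiate in the abscissa; b < lam keeps the pole of the kernel off the
    line and makes e^{(b - lam) t} decay. *)

Inductive vexp : Type :=
| VZero | VAtom (n : nat) | VPlus (e1 e2 : vexp) | VOpp (e : vexp) | VScal (c : C) (e : vexp).

Fixpoint veval (W : NormedModule C_AbsRing) (env : list W) (e : vexp) : W :=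
  match e with
  | VZero => zero
  | VAtom n => nth n env zero
  | VPlus e1 e2 => plus (veval env e1) (veval env e2)
  | VOpp e1 => opp (veval env e1)
  | VScal c e1 => scal (c : C_AbsRing) (veval env e1)
  end.

Fixpoint vcoef (e : vexp) (n : nat) : C :=
  match e with
  | VZero => RtoC 0
  | VAtom m => if Nat.eqb m n then RtoC 1 else RtoC 0
  | VPlus e1 e2 => Cplus (vcoef e1 n) (vcoef e2 n)
  | VOpp e1 => Copp (vcoef e1 n)
  | VScal c e1 => Cmult c (vcoef e1 n)
  end.

Fixpoint vsum (W : NormedModule C_AbsRing) (env : list W) (c : nat -> C) : W :=
  match env with
  | nil => zero
  | x :: l => plus (scal (c O : C_AbsRing) x) (vsum l (fun n => c (S n)))
  end.

(** Equality of coefficients only below k, as a recursive conjunction: for a concrete list of atoms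
    it computes to finitely many identities in [C], which [ring] or [field] can settle. *)
Fixpoint vceq (k : nat) (c d : nat -> C) : Prop :=
  match k with
  | O => True
  | S k' => c O = d O /\ vceq k' (fun n => c (S n)) (fun n => d (S n))
  end.

Section Vexp.
Variable W : NormedModule C_AbsRing.

Lemma vsum_ext (env : list W) (c d : nat -> C) :
  vceq (length env) c d -> vsum env c = vsum env d.
Proof.
revert c d; induction env as [|x l IH]; intros c d; simpl; [easy|].
intros [-> H]; now rewrite (IH _ _ H).
Qed.

Lemma vceq_refl (k : nat) (c d : nat -> C) : (forall n, c n = d n) -> vceq k c d.
Proof. revert c d; induction k; intros c d H; simpl; auto. Qed.

Lemma vsum_plus (env : list W) (c d : nat -> C) :
  vsum env (fun n => Cplus (c n) (d n)) = plus (vsum env c) (vsum env d).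
Proof.
revert c d; induction env as [|x l IH]; intros c d; simpl.
- now rewrite plus_zero_l.
- rewrite IH.
  transitivity (plus (plus (scal (c O : C_AbsRing) x) (scal (d O : C_AbsRing) x))
    (plus (vsum l (fun n => c (S n))) (vsum l (fun n => d (S n))))).
  { f_equal; exact (scal_distr_r (c O : C_AbsRing) (d O : C_AbsRing) x). }
  rewrite <- !plus_assoc; f_equal; rewrite !plus_assoc; f_equal; apply plus_comm.
Qed.

Lemma vsum_scal (env : list W) (a : C) (c : nat -> C) :
  vsum env (fun n => Cmult a (c n)) = scal (a : C_AbsRing) (vsum env c).
Proof.
revert c; induction env as [|x l IH]; intros c; simpl.
- symmetry; exact (scal_zero_r (a : C_AbsRing)).
- rewrite IH; symmetry.
  etransitivity; [exact (scal_distr_l (a : C_AbsRing) _ _)|]; f_equal.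
  exact (scal_assoc (a : C_AbsRing) (c O : C_AbsRing) x).
Qed.

Lemma vsum_zero (env : list W) : vsum env (fun _ => RtoC 0) = zero.
Proof.
induction env as [|x l IH]; simpl; [easy|].
rewrite IH, plus_zero_r; exact (scal_zero_l x).
Qed.

Lemma vsum_atom (env : list W) (m : nat) :
  vsum env (fun n => if Nat.eqb m n then RtoC 1 else RtoC 0) = nth m env zero.
Proof.
revert m; induction env as [|x l IH]; intros [|m]; simpl; try easy.
- rewrite vsum_zero, plus_zero_r; exact (scal_one x).
- rewrite (IH m).
  transitivity (plus zero (nth m l zero)); [f_equal; exact (scal_zero_l x)|apply plus_zero_l].
Qed.

Lemma vsum_opp (env : list W) (c : nat -> C) :
  vsum env (fun n => Copp (c n)) = opp (vsum env c).
Proof.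
transitivity (vsum env (fun n => Cmult (Copp (RtoC 1)) (c n))).
- apply vsum_ext, vceq_refl; intros n; ring.
- rewrite vsum_scal; exact (scal_opp_one (vsum env c)).
Qed.

Lemma veval_vsum (env : list W) (e : vexp) : veval env e = vsum env (vcoef e).
Proof.
induction e; simpl.
- symmetry; apply vsum_zero.
- symmetry; apply vsum_atom.
- now rewrite IHe1, IHe2, <- vsum_plus.
- now rewrite IHe, <- vsum_opp.
- now rewrite IHe, <- vsum_scal.
Qed.

Lemma veval_eq (env : list W) (e1 e2 : vexp) :
  vceq (length env) (vcoef e1) (vcoef e2) -> veval env e1 = veval env e2.
Proof. intros H; rewrite !veval_vsum; now apply vsum_ext. Qed.
End Vexp.

Ltac vmem x l :=
  match l with
  | nil => constr:(false)
  | x :: _ => constr:(true)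
  | _ :: ?t => vmem x t
  end.
Ltac vindex x l :=
  match l with
  | x :: _ => constr:(O)
  | _ :: ?t => let n := vindex x t in constr:(S n)
  end.
Ltac vatoms e l :=
  match e with
  | plus ?a ?b => let l1 := vatoms a l in vatoms b l1
  | minus ?a ?b => let l1 := vatoms a l in vatoms b l1
  | opp ?a => vatoms a l
  | scal _ ?a => vatoms a l
  | zero => l
  | _ => match vmem e l with true => l | false => constr:(e :: l) end
  end.
(** Real scalars of a [realification] are reified as complex scalars through [RtoC]. The [change] in
    [vlin] accepts this because [real_scal] unfolds to exactly that product, so a goal may mix both
    module structures. *)
Ltac vreify e l :=
  match e with
  | plus ?a ?b => let x := vreify a l in let y := vreify b l in constr:(VPlus x y)
  | minus ?a ?b => let x := vreify a l in let y := vreify b l in constr:(VPlus x (VOpp y))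
  | opp ?a => let x := vreify a l in constr:(VOpp x)
  | @scal R_Ring _ ?c ?a => let x := vreify a l in constr:(VScal (RtoC c) x)
  | @scal (AbsRing.Ring R_AbsRing) _ ?c ?a => let x := vreify a l in constr:(VScal (RtoC c) x)
  | scal ?c ?a => let x := vreify a l in constr:(VScal c x)
  | zero => constr:(VZero)
  | _ => let n := vindex e l in constr:(VAtom n)
  end.
(* Reduces an equation between linear combinations of vectors to the equality
   of the coefficients of each atomic vector. *)
Ltac vlin W :=
  match goal with
  | |- ?a = ?b =>
    let l0 := vatoms a constr:(@nil (NormedModule.sort C_AbsRing W)) in
    let l := vatoms b l0 in
    let x := vreify a l in
    let y := vreify b l in
    change (veval (W:=W) l x = veval (W:=W) l y);
    apply veval_eq; cbn [vceq vcoef length Nat.eqb];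
    repeat match goal with |- _ /\ _ => split | |- True => exact I end
  end.

(** * Symmetric improper integrals *)

Section RealCalculus.
Variable V : CompleteNormedModule R_AbsRing.

(** A quadratic remainder is below eps |y - x| once |y - x| < eps / (|K| + 1). Remainder bounds
    survive integration, so this is the criterion applied whenever a parameter integral is
    differentiated. *)
Lemma is_derive_quadratic (f : R -> V) (x : R) (l : V) (K : R) :
  locally x (fun y => norm (minus (minus (f y) (f x)) (scal (y - x) l)) <= K * (y - x) ^ 2) ->
  is_derive f x l.
Proof.
intros H; split.
- apply is_linear_scal_l.
- intros x0 Hx0.
  apply (is_filter_lim_locally_unique x x0) in Hx0; subst x0.
  intros eps.
  assert (HK : 0 < Rabs K + 1) by (pose proof (Rabs_pos K); lra).
  assert (Hd : 0 < eps / (Rabs K + 1)) by (apply Rdiv_lt_0_compat; [apply cond_pos|easy]).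
  generalize (filter_and _ _ H (locally_ball x (mkposreal _ Hd))); apply filter_imp.
  intros y [Hy1 Hy2].
  change (Rabs (y - x) < eps / (Rabs K + 1)) in Hy2.
  change (norm (minus (minus (f y) (f x)) (scal (y - x) l)) <= eps * Rabs (y - x)).
  eapply Rle_trans; [exact Hy1|].
  rewrite <- pow2_abs.
  pose proof (Rabs_pos (y - x)); pose proof (Rle_abs K).
  assert (Rabs (y - x) * (Rabs K + 1) <= eps).
  { apply (Rmult_lt_compat_r _ _ _ HK) in Hy2.
    unfold Rdiv in Hy2; rewrite Rmult_assoc, Rinv_l in Hy2; lra. }
  nra.
Qed.

Lemma continuous_lipschitz (f : R -> V) (x K : R) :
  locally x (fun y => norm (minus (f y) (f x)) <= K * Rabs (y - x)) -> continuous f x.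
Proof.
intros H; apply filterlim_locally; intros eps.
assert (HK : 0 < Rabs K + 1) by (pose proof (Rabs_pos K); lra).
assert (Hd : 0 < eps / (Rabs K + 1)) by (apply Rdiv_lt_0_compat; [apply cond_pos|easy]).
generalize (filter_and _ _ H (locally_ball x (mkposreal _ Hd))); apply filter_imp.
intros y [Hy1 Hy2].
change (Rabs (y - x) < eps / (Rabs K + 1)) in Hy2.
apply (@norm_compat1 R_AbsRing V); eapply Rle_lt_trans; [exact Hy1|].
pose proof (Rabs_pos (y - x)); pose proof (Rle_abs K).
apply (Rmult_lt_compat_r _ _ _ HK) in Hy2.
unfold Rdiv in Hy2; rewrite Rmult_assoc, Rinv_l in Hy2; [|lra].
nra.
Qed.

Lemma ex_RInt_cont (f : R -> V) (c d : R) : (forall s, continuous f s) -> ex_RInt f c d.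
Proof. intros H; apply ex_RInt_continuous; auto. Qed.

Lemma is_RInt_atan (K c d : R) :
  is_RInt (fun s => K / (1 + s ^ 2)) c d (K * (atan d - atan c)).
Proof.
replace (K * (atan d - atan c)) with (minus (K * atan d) (K * atan c))
  by (unfold minus, plus, opp; simpl; ring).
apply (is_RInt_derive (fun s => K * atan s)).
- intros x _; auto_derive; [easy|]; field; nra.
- intros x _; apply (ex_derive_continuous (fun s => K / (1 + s ^ 2))).
  auto_derive; nra.
Qed.

Lemma norm_RInt_atan (f : R -> V) (K c d : R) :
  (forall s, continuous f s) -> (forall s, norm (f s) <= K / (1 + s ^ 2)) ->
  c <= d -> norm (RInt f c d) <= K * (atan d - atan c).
Proof.
intros Hc Hb Hcd.
apply (norm_RInt_le f (fun s => K / (1 + s ^ 2)) c d); auto.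
- apply RInt_correct; now apply ex_RInt_cont.
- apply is_RInt_atan.
Qed.

Lemma atan_lim (eps : R) : 0 < eps -> exists M, 0 < M /\ forall L, M < L -> PI / 2 - atan L < eps.
Proof.
intros He.
destruct (Rle_lt_dec (PI / 2) eps) as [Hp|Hp].
- exists 1; split; [lra|]; intros L HL.
  pose proof (atan_increasing 0 L ltac:(lra)); rewrite atan_0 in H; lra.
- assert (H0 : 0 < PI / 2 - eps < PI / 2) by lra.
  exists (tan (PI / 2 - eps)); split; [apply tan_gt_0; lra|].
  intros L HL; apply atan_increasing in HL.
  rewrite atan_tan in HL; lra.
Qed.

(* Meaningful only when the limit exists: [lim] is unspecified on filters that are not Cauchy. *)
Definition pv (f : R -> V) : V :=
  lim (filtermap (fun L => RInt f (- L) L) (Rbar_locally p_infty)).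

(** The majorant has the primitive K atan, so tails are explicit and the constant K travels through
    the algebra of integrands, to return as K PI in [pv_norm]. *)
Definition integrable_bound (f : R -> V) (K : R) : Prop :=
  (forall s, continuous f s) /\ forall s, norm (f s) <= K / (1 + s ^ 2).

Lemma integrable_bound_ge_0 (f : R -> V) (K : R) : integrable_bound f K -> 0 <= K.
Proof.
intros [_ H]; specialize (H 0); pose proof (norm_ge_0 (f 0)); simpl in H.
replace (K / (1 + 0 * (0 * 1))) with K in H by field; lra.
Qed.

(** Only the pieces over [-L', -L] and [L, L'] remain; as atan is odd, each contributes at most K
    (atan L' - atan L), and atan L' < PI / 2. *)
Lemma RInt_symmetric_diff (f : R -> V) (K L L' : R) :
  integrable_bound f K -> 0 <= L <= L' ->
  norm (minus (RInt f (- L') L') (RInt f (- L) L)) <= 2 * K * (PI / 2 - atan L).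
Proof.
intros [Hc Hb] HL.
assert (E : minus (RInt f (- L') L') (RInt f (- L) L)
            = plus (RInt f (- L') (- L)) (RInt f L L')).
{ rewrite <- (RInt_Chasles f (- L') (- L) L') by now apply ex_RInt_cont.
  rewrite <- (RInt_Chasles f (- L) L L') by now apply ex_RInt_cont.
  unfold minus; rewrite <- plus_assoc; f_equal.
  rewrite plus_comm, plus_assoc, plus_opp_l; apply plus_zero_l. }
rewrite E; eapply Rle_trans; [apply (@norm_triangle R_AbsRing V)|].
pose proof (norm_RInt_atan (c := - L') (d := - L) Hc Hb ltac:(lra)).
pose proof (norm_RInt_atan (c := L) (d := L') Hc Hb ltac:(lra)).
rewrite !atan_opp in H.
pose proof (integrable_bound_ge_0 (conj Hc Hb)).
pose proof (atan_bound L'). nra.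
Qed.

Lemma pv_lim (f : R -> V) (K : R) :
  integrable_bound f K ->
  filterlim (fun L => RInt f (- L) L) (Rbar_locally p_infty) (locally (pv f)).
Proof.
intros Hf; apply filterlim_locally; intros eps; unfold pv.
apply (complete_cauchy (filtermap (fun L => RInt f (- L) L) (Rbar_locally p_infty))).
{ apply filtermap_proper_filter, Rbar_locally_filter. }
clear eps; intros eps.
pose proof (integrable_bound_ge_0 Hf).
destruct (@atan_lim (eps / (2 * K + 1))) as [M [HM0 HM]].
{ apply Rdiv_lt_0_compat; [apply cond_pos|lra]. }
exists (RInt f (- (M + 1)) (M + 1)).
exists (M + 1); intros L HL.
apply (@norm_compat1 R_AbsRing V); eapply Rle_lt_trans.
- apply (RInt_symmetric_diff (K := K)); [easy|lra].
- specialize (HM (M + 1) ltac:(lra)).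
  pose proof (atan_bound (M + 1)).
  apply (Rmult_lt_compat_l (2 * K + 1)) in HM; [|lra].
  replace ((2 * K + 1) * (eps / (2 * K + 1))) with (pos eps) in HM by (field; lra).
  nra.
Qed.

Lemma pv_unique (f : R -> V) (K : R) (v : V) :
  integrable_bound f K ->
  filterlim (fun L => RInt f (- L) L) (Rbar_locally p_infty) (locally v) -> pv f = v.
Proof.
intros Hf Hv.
exact (filterlim_locally_unique _ _ _ (pv_lim Hf) Hv).
Qed.

Lemma pv_norm (f : R -> V) (K : R) : integrable_bound f K -> norm (pv f) <= K * PI.
Proof.
intros Hf.
apply (filterlim_le (F := Rbar_locally p_infty)
  (fun L => norm (RInt f (- L) L)) (fun _ => K * PI) (norm (pv f)) (K * PI)).
- exists 0; intros L HL.
  eapply Rle_trans; [apply (norm_RInt_atan (K := K)); [apply Hf|apply Hf|lra]|].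
  rewrite atan_opp; pose proof (atan_bound L); pose proof (integrable_bound_ge_0 Hf).
  pose proof PI_RGT_0; nra.
- eapply filterlim_comp; [exact (pv_lim Hf)|apply (@filterlim_norm R_AbsRing V)].
- apply filterlim_const.
Qed.

Lemma integrable_bound_ext (f g : R -> V) (K : R) :
  (forall s, f s = g s) -> integrable_bound g K -> integrable_bound f K.
Proof.
intros H [H1 H2]; split; intros s.
- now apply (continuous_ext g).
- now rewrite H.
Qed.

Lemma pv_ext (f g : R -> V) (K : R) :
  (forall s, f s = g s) -> integrable_bound g K -> pv f = pv g.
Proof.
intros H Hg; apply (pv_unique (integrable_bound_ext H Hg)).
apply (filterlim_ext (fun L => RInt g (- L) L)); [|exact (pv_lim Hg)].
intros L; apply RInt_ext; intros x _; now rewrite H.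
Qed.

Lemma integrable_bound_plus (f g : R -> V) (K K' : R) :
  integrable_bound f K -> integrable_bound g K' ->
  integrable_bound (fun s => plus (f s) (g s)) (K + K').
Proof.
intros [H1 H2] [H3 H4]; split; intros s.
- now apply (continuous_plus f g).
- eapply Rle_trans; [apply (@norm_triangle R_AbsRing V)|].
  unfold Rdiv; rewrite Rmult_plus_distr_r; apply Rplus_le_compat; [apply H2|apply H4].
Qed.

Lemma pv_plus (f g : R -> V) (K K' : R) :
  integrable_bound f K -> integrable_bound g K' ->
  pv (fun s => plus (f s) (g s)) = plus (pv f) (pv g).
Proof.
intros Hf Hg; apply (pv_unique (integrable_bound_plus Hf Hg)).
apply (filterlim_ext (fun L => plus (RInt f (- L) L) (RInt g (- L) L))).
- intros L; symmetry; apply RInt_plus; apply ex_RInt_cont; [apply Hf|apply Hg].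
- eapply filterlim_comp_2; [exact (pv_lim Hf)|exact (pv_lim Hg)|].
  apply (filterlim_plus (V := V)).
Qed.

Lemma integrable_bound_minus (f g : R -> V) (K K' : R) :
  integrable_bound f K -> integrable_bound g K' ->
  integrable_bound (fun s => minus (f s) (g s)) (K + K').
Proof.
intros [H1 H2] [H3 H4]; split; intros s.
- now apply (continuous_minus f g).
- eapply Rle_trans; [apply (@norm_triangle R_AbsRing V)|].
  rewrite (@norm_opp R_AbsRing V).
  unfold Rdiv; rewrite Rmult_plus_distr_r; apply Rplus_le_compat; [apply H2|apply H4].
Qed.

Lemma pv_minus (f g : R -> V) (K K' : R) :
  integrable_bound f K -> integrable_bound g K' ->
  pv (fun s => minus (f s) (g s)) = minus (pv f) (pv g).
Proof.
intros Hf Hg; apply (pv_unique (integrable_bound_minus Hf Hg)).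
apply (filterlim_ext (fun L => plus (RInt f (- L) L) (opp (RInt g (- L) L)))).
- intros L; symmetry; apply RInt_minus; apply ex_RInt_cont; [apply Hf|apply Hg].
- eapply filterlim_comp_2; [exact (pv_lim Hf)| |apply (filterlim_plus (V := V))].
  eapply filterlim_comp; [exact (pv_lim Hg)|apply (filterlim_opp (V := V))].
Qed.

(** D may well be smaller than K. Sums and differences of integrands supply continuity with a crude
    constant; a separate pointwise estimate then supplies the constant that is small in t' - t. *)
Lemma integrable_bound_weaken (f : R -> V) (K D : R) :
  integrable_bound f K -> (forall s, norm (f s) <= D / (1 + s ^ 2)) -> integrable_bound f D.
Proof. intros [H _] HD; now split. Qed.

End RealCalculus.

(** * Complex exponentials of a real variable *)

Lemma Cmod_le_abs (z : C) : Cmod z <= Rabs (Re z) + Rabs (Im z).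
Proof.
unfold Cmod; destruct z as [x y]; unfold Re, Im; cbn [fst snd].
rewrite <- (sqrt_pow2 (Rabs x + Rabs y)).
2: pose proof (Rabs_pos x); pose proof (Rabs_pos y); lra.
apply sqrt_le_1_alt; rewrite <- (pow2_abs x), <- (pow2_abs y).
pose proof (Rabs_pos x); pose proof (Rabs_pos y); nra.
Qed.

Lemma Re_le_Cmod (z : C) : Rabs (Re z) <= Cmod z.
Proof. eapply Rle_trans; [apply Rmax_l|apply Rmax_Cmod]. Qed.

Lemma Im_le_Cmod (z : C) : Rabs (Im z) <= Cmod z.
Proof. eapply Rle_trans; [apply Rmax_r|apply Rmax_Cmod]. Qed.

Definition expC (mu : C) (t : R) : C :=
  (exp (Re mu * t) * cos (Im mu * t), exp (Re mu * t) * sin (Im mu * t)).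

Lemma Cmod_expC (mu : C) (t : R) : Cmod (expC mu t) = exp (Re mu * t).
Proof.
unfold Cmod, expC; cbn [fst snd].
replace (_ ^ 2 + _ ^ 2) with (exp (Re mu * t) ^ 2).
- apply sqrt_pow2, Rlt_le, exp_pos.
- pose proof (sin2_cos2 (Im mu * t)) as H; unfold Rsqr in H.
  replace (_ + _) with (exp (Re mu * t) ^ 2 *
    (sin (Im mu * t) * sin (Im mu * t) + cos (Im mu * t) * cos (Im mu * t))) by ring.
  rewrite H; ring.
Qed.

Lemma expC_0 (mu : C) : expC mu 0 = RtoC 1.
Proof.
unfold expC; rewrite !Rmult_0_r, exp_0, cos_0, sin_0.
apply injective_projections; simpl; ring.
Qed.

Lemma expC_shift (a s lam t : R) :
  Cmult (RtoC (exp (- (lam * t)))) (expC (a, s) t) = expC (a - lam, s) t.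
Proof.
unfold expC, Re, Im; cbn [fst snd].
replace ((a - lam) * t) with (- (lam * t) + a * t) by ring.
rewrite exp_plus; apply injective_projections; simpl; ring.
Qed.

(** The factor c lets the statement iterate: with c mu in place of c it provides the second
    derivative. *)
Lemma is_derive_Re_expC (c mu : C) (t : R) :
  is_derive (fun t => Re (Cmult c (expC mu t))) t (Re (Cmult (Cmult c mu) (expC mu t))).
Proof.
destruct c as [c1 c2], mu as [x y]; unfold expC, Re, Im; simpl.
auto_derive; [easy|]; ring.
Qed.

Lemma is_derive_Im_expC (c mu : C) (t : R) :
  is_derive (fun t => Im (Cmult c (expC mu t))) t (Im (Cmult (Cmult c mu) (expC mu t))).
Proof.
destruct c as [c1 c2], mu as [x y]; unfold expC, Re, Im; simpl.
auto_derive; [easy|]; ring.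
Qed.

Lemma lipschitz_of_derive (f f' : R -> R) (x y K : R) :
  (forall t, is_derive f t (f' t)) ->
  (forall t, Rmin x y <= t <= Rmax x y -> Rabs (f' t) <= K) ->
  Rabs (f y - f x) <= K * Rabs (y - x).
Proof.
intros Hf HK.
destruct (MVT_gen f x y f') as [c [Hc E]].
- auto.
- intros t _; apply continuity_pt_filterlim, (ex_derive_continuous f); eexists; apply Hf.
- rewrite E, Rabs_mult; apply Rmult_le_compat_r; [apply Rabs_pos|]; auto.
Qed.

(** The mean value theorem is used twice, for f and then for f' between x and the intermediate
    point. This gives K instead of the optimal K / 2, which is harmless here. *)
Lemma taylor2_of_derive (f f' f'' : R -> R) (x y K : R) :
  (forall t, is_derive f t (f' t)) -> (forall t, is_derive f' t (f'' t)) ->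
  (forall t, Rmin x y <= t <= Rmax x y -> Rabs (f'' t) <= K) ->
  Rabs (f y - f x - (y - x) * f' x) <= K * (y - x) ^ 2.
Proof.
intros Hf Hf' HK.
destruct (MVT_gen f x y f') as [c [Hc E]].
- auto.
- intros t _; apply continuity_pt_filterlim, (ex_derive_continuous f); eexists; apply Hf.
- rewrite E.
  replace (f' c * (y - x) - (y - x) * f' x) with ((f' c - f' x) * (y - x)) by ring.
  rewrite Rabs_mult, <- (pow2_abs (y - x)).
  assert (H : Rabs (f' c - f' x) <= K * Rabs (c - x)).
  { apply (lipschitz_of_derive Hf').
    intros t Ht; apply HK; revert Ht Hc; unfold Rmin, Rmax.
    repeat destruct Rle_dec; lra. }
  assert (H2 : Rabs (c - x) <= Rabs (y - x)).
  { revert Hc; unfold Rmin, Rmax, Rabs; repeat destruct Rle_dec; repeat destruct Rcase_abs; lra. }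
  assert (H3 : 0 <= K) by (eapply Rle_trans; [apply Rabs_pos|apply (HK c Hc)]).
  pose proof (Rabs_pos (y - x)).
  simpl; rewrite Rmult_1_r, <- Rmult_assoc.
  apply Rmult_le_compat_r; [easy|]; nra.
Qed.

(** The mean value theorem fails for complex-valued functions, so real and imaginary parts are
    estimated separately; this is the origin of the factor 2, here and in [expC_taylor2]. *)
Lemma expC_lipschitz (mu : C) (t t' B : R) :
  (forall r, Rmin t t' <= r <= Rmax t t' -> exp (Re mu * r) <= B) ->
  Cmod (Cminus (expC mu t') (expC mu t)) <= 2 * (Cmod mu * B) * Rabs (t' - t).
Proof.
intros HB.
assert (Hb : forall r, Rmin t t' <= r <= Rmax t t' ->
  Cmod (Cmult (Cmult (RtoC 1) mu) (expC mu r)) <= Cmod mu * B).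
{ intros r Hr; rewrite Cmult_1_l, Cmod_mult, Cmod_expC.
  apply Rmult_le_compat_l; [apply Cmod_ge_0|auto]. }
eapply Rle_trans; [apply Cmod_le_abs|].
rewrite (Rmult_assoc 2), <- Rplus_diag; apply Rplus_le_compat.
- replace (Re _) with (Re (Cmult (RtoC 1) (expC mu t')) - Re (Cmult (RtoC 1) (expC mu t)))
    by (simpl; ring).
  apply (lipschitz_of_derive (fun r => is_derive_Re_expC (RtoC 1) mu r)).
  intros r Hr; eapply Rle_trans; [apply Re_le_Cmod|auto].
- replace (Im _) with (Im (Cmult (RtoC 1) (expC mu t')) - Im (Cmult (RtoC 1) (expC mu t)))
    by (simpl; ring).
  apply (lipschitz_of_derive (fun r => is_derive_Im_expC (RtoC 1) mu r)).
  intros r Hr; eapply Rle_trans; [apply Im_le_Cmod|auto].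
Qed.

Lemma expC_taylor2 (mu : C) (t t' B : R) :
  (forall r, Rmin t t' <= r <= Rmax t t' -> exp (Re mu * r) <= B) ->
  Cmod (Cminus (Cminus (expC mu t') (expC mu t)) (Cmult (RtoC (t' - t)) (Cmult mu (expC mu t))))
  <= 2 * (Cmod mu ^ 2 * B) * (t' - t) ^ 2.
Proof.
intros HB.
assert (Hb : forall r, Rmin t t' <= r <= Rmax t t' ->
  Cmod (Cmult (Cmult (Cmult (RtoC 1) mu) mu) (expC mu r)) <= Cmod mu ^ 2 * B).
{ intros r Hr; rewrite Cmult_1_l, !Cmod_mult, Cmod_expC; simpl; rewrite Rmult_1_r.
  apply Rmult_le_compat_l; [|auto].
  apply Rmult_le_pos; apply Cmod_ge_0. }
eapply Rle_trans; [apply Cmod_le_abs|].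
rewrite (Rmult_assoc 2), <- Rplus_diag; apply Rplus_le_compat.
- replace (Re _) with (Re (Cmult (RtoC 1) (expC mu t')) - Re (Cmult (RtoC 1) (expC mu t))
    - (t' - t) * Re (Cmult (Cmult (RtoC 1) mu) (expC mu t)))
    by (simpl; ring).
  apply (taylor2_of_derive (fun r => is_derive_Re_expC (RtoC 1) mu r)
    (fun r => is_derive_Re_expC (Cmult (RtoC 1) mu) mu r)).
  intros r Hr; eapply Rle_trans; [apply Re_le_Cmod|auto].
- replace (Im _) with (Im (Cmult (RtoC 1) (expC mu t')) - Im (Cmult (RtoC 1) (expC mu t))
    - (t' - t) * Im (Cmult (Cmult (RtoC 1) mu) (expC mu t)))
    by (simpl; ring).
  apply (taylor2_of_derive (fun r => is_derive_Im_expC (RtoC 1) mu r)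
    (fun r => is_derive_Im_expC (Cmult (RtoC 1) mu) mu r)).
  intros r Hr; eapply Rle_trans; [apply Im_le_Cmod|auto].
Qed.

(** * Complex scalars and real integrals *)

Section ComplexCalculus.
Variable W : CompleteNormedModule C_AbsRing.
Let V := realification W.

Lemma norm_cscal (c : C) (x : W) : norm (scal (c : C_AbsRing) x) <= Cmod c * norm x.
Proof. exact (norm_scal (c : C_AbsRing) x). Qed.

(** Multiplication by a varying complex scalar becomes two real scalar multiplications, of x and of
    the vector i x, so the calculus of real normed modules applies. *)
Lemma cscal_split (r i : R) (x : W) :
  scal ((r, i) : C_AbsRing) x =
  plus (scal r (x : V)) (scal i (scal (Ci : C_AbsRing) x : V)).
Proof. vlin W; apply injective_projections; simpl; ring. Qed.

Lemma continuous_cscal (u v : R -> R) (f : R -> W) (s : R) :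
  continuous u s -> continuous v s -> continuous f s ->
  continuous (fun s => scal ((u s, v s) : C_AbsRing) (f s)) s.
Proof.
intros Hu Hv Hf.
apply (continuous_ext (fun s => plus (scal (u s) (f s : V)) (scal (v s) (scal (Ci : C_AbsRing) (f s) : V)))).
{ intros r; symmetry; apply cscal_split. }
apply (@continuous_plus _ _ V (fun s => scal (u s) (f s : V))
  (fun s => scal (v s) (scal (Ci : C_AbsRing) (f s) : V))).
- apply (@continuous_scal _ R_AbsRing V u f); auto.
- apply (@continuous_scal _ R_AbsRing V v (fun s => scal (Ci : C_AbsRing) (f s))); auto.
  apply (@continuous_scal_r _ C_AbsRing W Ci f); auto.
Qed.

Lemma continuous_cscal_const (c : C) (f : R -> W) (s : R) :
  continuous f s -> continuous (fun s => scal (c : C_AbsRing) (f s)) s.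
Proof. apply (@continuous_scal_r _ C_AbsRing W c f). Qed.

Lemma is_derive_cscal (u v : R -> R) (u' v' s : R) (x : W) :
  is_derive u s u' -> is_derive v s v' ->
  is_derive (fun s => scal ((u s, v s) : C_AbsRing) x : V) s (scal ((u', v') : C_AbsRing) x).
Proof.
intros Hu Hv.
apply (is_derive_ext (fun s => plus (scal (u s) (x : V)) (scal (v s) (scal (Ci : C_AbsRing) x : V)))).
{ intros r; symmetry; apply cscal_split. }
rewrite cscal_split.
apply (@is_derive_plus R_AbsRing V).
- apply (@is_derive_scal_l R_AbsRing V u); auto.
- apply (@is_derive_scal_l R_AbsRing V v); auto.
Qed.

(** A complex constant is not a scalar of [V], hence its passage through the integral has to be
    established on Riemann sums. *)
Lemma Riemann_sum_cscal (c : C) (f : R -> V) (ptd : SF_seq) :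
  Riemann_sum (fun s => scal (c : C_AbsRing) (f s : W) : V) ptd =
  scal (c : C_AbsRing) (Riemann_sum f ptd : W).
Proof.
apply (SF_cons_ind (fun ptd => Riemann_sum (fun s => scal (c : C_AbsRing) (f s : W) : V) ptd =
  scal (c : C_AbsRing) (Riemann_sum f ptd : W))).
- intros x; unfold Riemann_sum; simpl; symmetry; exact (scal_zero_r (c : C_AbsRing)).
- intros h p IH; rewrite !Riemann_sum_cons, IH.
  vlin W; ring.
Qed.

Lemma is_RInt_cscal (c : C) (f : R -> V) (a b : R) (I : V) :
  is_RInt f a b I -> is_RInt (fun s => scal (c : C_AbsRing) (f s : W) : V) a b
    (scal (c : C_AbsRing) (I : W)).
Proof.
unfold is_RInt; intros H.
apply (filterlim_ext (fun ptd => scal (c : C_AbsRing) (scal (sign (b - a)) (Riemann_sum f ptd) : W))).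
- intros ptd; rewrite Riemann_sum_cscal; vlin W; ring.
- eapply filterlim_comp; [exact H|].
  apply (@filterlim_scal_r C_AbsRing W).
Qed.

Lemma integrable_bound_cscal (c : C) (f : R -> V) (K : R) :
  integrable_bound f K -> integrable_bound (fun s => scal (c : C_AbsRing) (f s : W) : V) (Cmod c * K).
Proof.
intros [H1 H2]; split; intros s.
- apply continuous_cscal_const, H1.
- eapply Rle_trans; [exact (norm_cscal c (f s))|].
  unfold Rdiv; rewrite Rmult_assoc; apply Rmult_le_compat_l; [apply Cmod_ge_0|apply H2].
Qed.

Lemma pv_cscal (c : C) (f : R -> V) (K : R) :
  integrable_bound f K ->
  pv (fun s => scal (c : C_AbsRing) (f s : W) : V) = scal (c : C_AbsRing) (pv f : W).
Proof.
intros Hf; apply (pv_unique (integrable_bound_cscal c Hf)).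
apply (filterlim_ext (fun L => scal (c : C_AbsRing) (RInt f (- L) L : W))).
- intros L; symmetry; apply (@is_RInt_unique V), is_RInt_cscal, RInt_correct.
  apply ex_RInt_cont, Hf.
- eapply filterlim_comp; [exact (pv_lim Hf)|].
  apply (@filterlim_scal_r C_AbsRing W).
Qed.

End ComplexCalculus.

(** * Cauchy's theorem on vertical lines *)

Section HalfPlane.
Variable W : CompleteNormedModule C_AbsRing.
Let V := realification W.

(* [H'] is the complex derivative of [H], with a quadratic remainder that is uniform
   on bounded parts of the half-plane: this is what lets one differentiate under
   the integral sign without a compactness argument. *)
Definition holomorphic_with (a : R) (H H' : C -> W) : Prop :=
  forall M, exists K, forall z z', a <= Re z -> a <= Re z' -> Cmod z <= M -> Cmod z' <= M ->
    norm (H z) <= K /\ norm (H' z) <= K /\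
    norm (minus (minus (H z') (H z)) (scal (Cminus z' z : C_AbsRing) (H' z)))
      <= K * Cmod (Cminus z' z) ^ 2.

Lemma norm_cscal_inv (c : C) (x : W) (k : R) :
  norm (scal (c : C_AbsRing) x) <= k * Cmod c ^ 2 -> 0 <= k -> c <> RtoC 0 -> norm x <= k * Cmod c.
Proof.
intros H Hk Hc.
replace x with (scal (Cinv c : C_AbsRing) (scal (c : C_AbsRing) x)).
- eapply Rle_trans; [apply norm_cscal|].
  pose proof (Cmod_gt_0 c) as [Hp _]; specialize (Hp Hc).
  rewrite Cmod_inv by easy.
  apply (Rmult_le_reg_l (Cmod c)); [easy|].
  rewrite <- Rmult_assoc, Rinv_r, Rmult_1_l by lra.
  simpl in H; lra.
- vlin W; field; easy.
Qed.

Lemma Cminus_swap_abs (z z' : C) : Cmod (Cminus z z') = Cmod (Cminus z' z).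
Proof. rewrite <- Cmod_opp; f_equal; ring. Qed.

(** Adding the remainders taken from z to z' and from z' to z cancels H and leaves (z' - z)(H'(z') -
    H'(z)), of size at most 2 K |z' - z|^2. Division by z' - z shows that H' is Lipschitz, although
    [holomorphic_with] only bounds it. *)
Lemma holomorphic_with_lipschitz (a : R) (H H' : C -> W) :
  holomorphic_with a H H' ->
  forall M, exists K, forall z z', a <= Re z -> a <= Re z' -> Cmod z <= M -> Cmod z' <= M ->
    norm (minus (H z') (H z)) <= K * Cmod (Cminus z' z) /\
    norm (minus (H' z') (H' z)) <= K * Cmod (Cminus z' z).
Proof.
intros HH M; destruct (HH M) as [K HK].
(* The first two summands serve H, whose quadratic remainder is linearised by |z' - z| <= 2 M; the
   last two serve H'. *)
exists (K * (2 * M) + K + (K + K)); intros z z' Hz Hz' HM HM'.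
destruct (HK z z' Hz Hz' HM HM') as [H1 [H2 H3]].
destruct (HK z' z Hz' Hz HM' HM) as [_ [_ H4]].
assert (HK0 : 0 <= K) by (eapply Rle_trans; [|exact H1]; apply norm_ge_0).
pose proof (Cmod_ge_0 (Cminus z' z)) as Hd.
assert (Hd2 : Cmod (Cminus z' z) <= 2 * M).
{ eapply Rle_trans; [apply Cmod_triangle|]; rewrite Cmod_opp; lra. }
assert (HM0 : 0 <= M) by (eapply Rle_trans; [apply Cmod_ge_0|apply HM]).
split.
- replace (minus (H z') (H z)) with
    (plus (minus (minus (H z') (H z)) (scal (Cminus z' z : C_AbsRing) (H' z)))
      (scal (Cminus z' z : C_AbsRing) (H' z))) by (vlin W; ring).
  eapply Rle_trans; [apply (@norm_triangle C_AbsRing W)|].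
  eapply Rle_trans; [apply Rplus_le_compat; [exact H3|apply (@norm_cscal W)]|].
  assert (Cmod (Cminus z' z) ^ 2 <= 2 * M * Cmod (Cminus z' z)) by (simpl; nra).
  assert (K * Cmod (Cminus z' z) ^ 2 <= K * (2 * M * Cmod (Cminus z' z))) by nra.
  nra.
- destruct (Ceq_dec z' z) as [->|Hne].
  { replace (minus (H' z) (H' z)) with (zero : W) by (vlin W; ring).
    apply Rle_trans with 0; [right; exact (@norm_zero C_AbsRing W)|]; apply Rmult_le_pos; [nra|easy]. }
  assert (Hc : Cminus z' z <> RtoC 0).
  { intros E; apply Hne; replace z' with (Cplus (Cminus z' z) z) by ring; rewrite E; ring. }
  eapply Rle_trans; [apply (@norm_cscal_inv (Cminus z' z) _ (K + K)); [|lra|easy]|].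
  + replace (scal (Cminus z' z : C_AbsRing) (minus (H' z') (H' z))) with
      (plus (minus (minus (H z') (H z)) (scal (Cminus z' z : C_AbsRing) (H' z)))
        (minus (minus (H z) (H z')) (scal (Cminus z z' : C_AbsRing) (H' z'))))
      by (vlin W; ring).
    eapply Rle_trans; [apply (@norm_triangle C_AbsRing W)|].
    rewrite Cminus_swap_abs in H4; lra.
  + apply Rmult_le_compat_r; [easy|]; nra.
Qed.

Variables (a : R) (H H' : C -> W).
Hypothesis HH : holomorphic_with a H H'.

Lemma Cmod_vertical (b s s' : R) : Cmod (Cminus (b, s') (b, s)) = Rabs (s' - s).
Proof.
replace (Cminus (b, s') (b, s)) with (Cmult Ci (RtoC (s' - s))).
- rewrite Cmod_mult, Cmod_Ci, Cmod_R; ring.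
- apply injective_projections; simpl; ring.
Qed.

Lemma Cmod_horizontal (b b' s : R) : Cmod (Cminus (b', s) (b, s)) = Rabs (b' - b).
Proof.
replace (Cminus (b', s) (b, s)) with (RtoC (b' - b)).
- apply Cmod_R.
- apply injective_projections; simpl; ring.
Qed.

Lemma Cmod_le_near (z z' : C) (r : R) : Cmod (Cminus z' z) <= r -> Cmod z' <= Cmod z + r.
Proof.
intros Hr; replace z' with (Cplus z (Cminus z' z)) by ring.
eapply Rle_trans; [apply Cmod_triangle|lra].
Qed.

Lemma continuous_vertical (b s : R) : a <= b ->
  continuous (fun s => H (b, s)) s /\ continuous (fun s => H' (b, s)) s.
Proof.
intros Hb.
destruct (holomorphic_with_lipschitz HH (Cmod (b, s) + 1)) as [K HK].
assert (L : locally s (fun y => norm (minus (H (b, y)) (H (b, s))) <= K * Rabs (y - s) /\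
  norm (minus (H' (b, y)) (H' (b, s))) <= K * Rabs (y - s))).
{ exists (mkposreal 1 Rlt_0_1); intros y Hy.
  change (Rabs (y - s) < 1) in Hy.
  rewrite <- (Cmod_vertical b); apply HK; simpl; try lra.
  apply Cmod_le_near; rewrite Cmod_vertical; lra. }
split; apply (@continuous_lipschitz V _ _ K); revert L; apply filter_imp; now intros y [? ?].
Qed.

Lemma continuous_horizontal (b s : R) : a < b -> continuous (fun x => H (x, s)) b.
Proof.
intros Hb.
destruct (holomorphic_with_lipschitz HH (Cmod (b, s) + 1)) as [K HK].
apply (@continuous_lipschitz V _ _ K).
assert (Hp : 0 < Rmin 1 (b - a)) by (apply Rmin_pos; lra).
exists (mkposreal _ Hp); intros y Hy.
change (Rabs (y - b) < Rmin 1 (b - a)) in Hy.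
pose proof (Rmin_l 1 (b - a)); pose proof (Rmin_r 1 (b - a)).
assert (a <= y) by (apply Rabs_def2 in Hy; lra).
rewrite <- (Cmod_horizontal _ _ s); apply HK; simpl; try lra.
apply Cmod_le_near; rewrite Cmod_horizontal; lra.
Qed.

Lemma is_derive_vertical (b s : R) : a <= b ->
  is_derive (fun s => H (b, s) : V) s (scal (Ci : C_AbsRing) (H' (b, s))).
Proof.
intros Hb.
destruct (HH (Cmod (b, s) + 1)) as [K HK].
apply (@is_derive_quadratic V _ _ _ K).
exists (mkposreal 1 Rlt_0_1); intros y Hy.
change (Rabs (y - s) < 1) in Hy.
rewrite <- pow2_abs, <- (Cmod_vertical b).
destruct (HK (b, s) (b, y)) as [_ [_ Q]]; simpl; try lra.
{ apply Cmod_le_near; rewrite Cmod_vertical; lra. }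
eapply Rle_trans; [|exact Q].
right.
match goal with |- ?l = ?r => change (norm (minus (minus (H (b, y)) (H (b, s)))
  (scal (RtoC (y - s) : C_AbsRing) (scal (Ci : C_AbsRing) (H' (b, s))))) = r) end.
f_equal; vlin W; apply injective_projections; simpl; ring.
Qed.

(** Together with [is_derive_RInt_horizontal] this expresses the x-derivative of the integral of H
    over the segment from x - iL to x + iL by the values of H at its endpoints. Cauchy's theorem on
    a rectangle thereby becomes the fundamental theorem of calculus in x. *)
Lemma is_RInt_vertical (b L : R) : a <= b ->
  is_RInt (fun s => H' (b, s) : V) (- L) L
    (scal (Copp Ci : C_AbsRing) (minus (H (b, L)) (H (b, - L)))).
Proof.
intros Hb.
apply (@is_RInt_ext V (fun s => scal (Copp Ci : C_AbsRing) (scal (Ci : C_AbsRing) (H' (b, s))))).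
{ intros s _; vlin W; apply injective_projections; simpl; ring. }
apply (@is_RInt_cscal W (Copp Ci) (fun s => scal (Ci : C_AbsRing) (H' (b, s)))).
apply (@is_RInt_derive V (fun s => H (b, s))).
- intros s _; now apply is_derive_vertical.
- intros s _; apply continuous_cscal_const; now apply continuous_vertical.
Qed.

(** The remainder bound of [holomorphic_with] is uniform over the segment of length 2 L, so
    integrating it gives the quadratic remainder 2 L K (y - b)^2. *)
Lemma is_derive_RInt_horizontal (b L : R) : a < b -> 0 <= L ->
  is_derive (fun x => RInt (fun s => H (x, s) : V) (- L) L) b
    (RInt (fun s => H' (b, s) : V) (- L) L).
Proof.
intros Hb HL.
destruct (HH (Cmod (b, 0) + L + 1)) as [K HK].
apply (@is_derive_quadratic V _ _ _ (2 * L * K)).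
assert (Hp : 0 < Rmin 1 (b - a)) by (apply Rmin_pos; lra).
exists (mkposreal _ Hp); intros y Hy.
change (Rabs (y - b) < Rmin 1 (b - a)) in Hy.
pose proof (Rmin_l 1 (b - a)); pose proof (Rmin_r 1 (b - a)).
assert (Hy' : a <= y) by (apply Rabs_def2 in Hy; lra).
assert (E1 : forall x, a <= x -> ex_RInt (fun s => H (x, s) : V) (- L) L).
{ intros x Hx; apply (@ex_RInt_cont V); intros s; now apply continuous_vertical. }
assert (E2 : ex_RInt (fun s => H' (b, s) : V) (- L) L).
{ apply (@ex_RInt_cont V); intros s; apply continuous_vertical; lra. }
replace (2 * L * K * (y - b) ^ 2) with ((L - - L) * (K * (y - b) ^ 2)) by ring.
eapply (@norm_RInt_le_const V (fun s => minus (minus (H (y, s) : V) (H (b, s)))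
  (scal (y - b) (H' (b, s) : V)))).
- lra.
- intros s Hs.
  assert (Hm : Cmod (b, s) <= Cmod (b, 0) + L).
  { apply Cmod_le_near; rewrite Cmod_vertical; apply Rabs_le; lra. }
  rewrite <- pow2_abs, <- (Cmod_horizontal _ _ s).
  destruct (HK (b, s) (y, s)) as [_ [_ Q]]; simpl; try lra.
  { apply Rle_trans with (Cmod (b, s) + 1); [|lra].
    apply Cmod_le_near; rewrite Cmod_horizontal; lra. }
  eapply Rle_trans; [|exact Q].
  right.
  match goal with |- ?l = ?r => change (norm (minus (minus (H (y, s)) (H (b, s)))
    (scal (RtoC (y - b) : C_AbsRing) (H' (b, s)))) = r) end.
  f_equal; vlin W; apply injective_projections; simpl; ring.
- apply (@is_RInt_minus V (fun s => minus (H (y, s)) (H (b, s))) (fun s => scal (y - b) (H' (b, s) : V))).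
  + apply (@is_RInt_minus V); apply RInt_correct; apply E1; lra.
  + apply (@is_RInt_scal V); now apply RInt_correct.
Qed.

Variable D : R.
Hypothesis a_ge_1 : 1 <= a.
Hypothesis decay : forall z, a <= Re z -> norm (H z) <= D / Cmod z ^ 2.

Lemma decay_ge_0 : 0 <= D.
Proof.
specialize (decay (z := (a, 0)) (Rle_refl a)).
pose proof (norm_ge_0 (H (a, 0))).
assert (0 < Cmod (a, 0)) by (pose proof (Re_le_Cmod (a, 0)); simpl in *; pose proof (Rle_abs a); lra).
apply (Rmult_le_reg_r (/ Cmod (a, 0) ^ 2)); [apply Rinv_0_lt_compat; nra|].
unfold Rdiv in decay; lra.
Qed.

Lemma decay_far (z : C) (r : R) : a <= Re z -> 0 < r -> r <= Cmod z -> norm (H z) <= D / r ^ 2.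
Proof.
intros Hz Hr Hrz; eapply Rle_trans; [now apply decay|].
apply Rmult_le_compat_l; [apply decay_ge_0|].
apply Rinv_le_contravar; [nra|]; apply pow_incr; lra.
Qed.

Lemma Cmod_vertical_sq (b s : R) : Cmod (b, s) ^ 2 = b ^ 2 + s ^ 2.
Proof. unfold Cmod; rewrite pow2_sqrt; simpl; nra. Qed.

Lemma integrable_bound_vertical (b : R) : a <= b -> integrable_bound (fun s => H (b, s) : V) D.
Proof.
intros Hb; split; intros s.
- now apply continuous_vertical.
- eapply Rle_trans; [apply (@decay (b, s)); exact Hb|].
  apply Rmult_le_compat_l; [apply decay_ge_0|].
  rewrite Cmod_vertical_sq; apply Rinv_le_contravar; nra.
Qed.

(* The rectangle with corners [b - iL] and [L + iL]: all three sides other than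
   the left one contribute O(1/L). *)
Lemma RInt_vertical_le (b L : R) : a < b -> b <= L ->
  norm (RInt (fun s => H (b, s) : V) (- L) L) <= 4 * D / L.
Proof.
intros Hb HL.
pose proof decay_ge_0 as HD.
assert (Hf : forall x, a <= x -> forall s, continuous (fun s => H (x, s)) s).
{ intros x Hx s; now apply continuous_vertical. }
set (J := fun x => RInt (fun s => H (x, s) : V) (- L) L).
assert (HJ : is_RInt (fun x => scal (Copp Ci : C_AbsRing) (minus (H (x, L)) (H (x, - L))) : V)
  b L (minus (J L) (J b))).
{ apply (@is_RInt_derive V J); intros x Hx; rewrite Rmin_left, Rmax_right in Hx by lra.
  - rewrite <- (is_RInt_unique (V := V) _ _ _ _ (@is_RInt_vertical x L ltac:(lra))).
    apply is_derive_RInt_horizontal; lra.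
  - apply continuous_cscal_const.
    apply (@continuous_minus _ _ W (fun x => H (x, L)) (fun x => H (x, - L)));
      apply continuous_horizontal; lra. }
assert (B1 : norm (minus (J L) (J b)) <= (L - b) * (2 * (D / L ^ 2))).
{ refine (@norm_RInt_le_const V (fun x => scal (Copp Ci : C_AbsRing) (minus (H (x, L)) (H (x, - L))))
    b L _ _ HL _ HJ).
  intros x Hx.
  eapply Rle_trans; [apply norm_cscal|].
  rewrite Cmod_opp, Cmod_Ci, Rmult_1_l.
  eapply Rle_trans; [apply (@norm_triangle C_AbsRing W)|].
  rewrite (@norm_opp C_AbsRing W).
  assert (G1 : norm (H (x, L)) <= D / L ^ 2).
  { apply decay_far; simpl; try lra.
    pose proof (Im_le_Cmod (x, L)); simpl in *; pose proof (Rle_abs L); lra. }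
  assert (G2 : norm (H (x, - L)) <= D / L ^ 2).
  { apply decay_far; simpl; try lra.
    pose proof (Im_le_Cmod (x, - L)); simpl in *; pose proof (Rle_abs L); rewrite Rabs_Ropp in *; lra. }
  lra. }
assert (B2 : norm (J L) <= (L - - L) * (D / L ^ 2)).
{ apply (@norm_RInt_le_const V (fun s => H (L, s)) (- L) L); [lra| |].
  - intros s _; apply decay_far; simpl; try lra.
    pose proof (Re_le_Cmod (L, s)); simpl in *; pose proof (Rle_abs L); lra.
  - apply RInt_correct, (@ex_RInt_cont V), Hf; lra. }
change (norm (J b) <= 4 * D / L).
replace (J b) with (minus (J L) (minus (J L) (J b))) by (vlin W; ring).
eapply Rle_trans; [apply (@norm_triangle R_AbsRing V)|].
rewrite (@norm_opp R_AbsRing V).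
eapply Rle_trans; [apply Rplus_le_compat; [exact B2|exact B1]|].
apply (Rmult_le_reg_r (L ^ 2)); [nra|].
replace (4 * D / L * L ^ 2) with (4 * D * L) by (field; lra).
replace (((L - - L) * (D / L ^ 2) + (L - b) * (2 * (D / L ^ 2))) * L ^ 2) with
  (2 * L * D + (L - b) * (2 * D)) by (field; lra).
nra.
Qed.

Lemma pv_vertical (b : R) : a < b -> pv (fun s => H (b, s) : V) = zero.
Proof.
intros Hb; apply (pv_unique (integrable_bound_vertical (b := b) ltac:(lra))).
apply filterlim_locally; intros eps.
pose proof decay_ge_0 as HD.
exists (Rmax b (4 * D / eps)); intros L HL.
pose proof (Rmax_l b (4 * D / eps)); pose proof (Rmax_r b (4 * D / eps)).
apply (@norm_compat1 R_AbsRing V); 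
match goal with |- norm ?x < _ =>
  replace x with (RInt (fun s => H (b, s) : V) (- L) L) by (vlin W; ring) end.
eapply Rle_lt_trans; [apply RInt_vertical_le; lra|].
pose proof (cond_pos eps).
apply (Rmult_lt_reg_r L); [lra|].
replace (4 * D / L * L) with (4 * D / eps * eps) by (field; lra).
rewrite (Rmult_comm eps); apply Rmult_lt_compat_r; lra.
Qed.
End HalfPlane.

(** * Powers of 1 / z on a half-plane *)

Section HolomorphicExamples.
Variable W : CompleteNormedModule C_AbsRing.
Let V := realification W.
Variable a : R.
Hypothesis a_ge_1 : 1 <= a.

Lemma Cmod_ge_1 (z : C) : a <= Re z -> 1 <= Cmod z.
Proof. intros Hz; pose proof (Re_le_Cmod z); pose proof (Rle_abs (Re z)); lra. Qed.

Lemma halfplane_nz (z : C) : a <= Re z -> z <> RtoC 0.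
Proof. intros Hz E; pose proof (Cmod_ge_1 Hz); rewrite E, Cmod_0 in H; lra. Qed.

Lemma Cmod_Cinv_le_1 (z : C) : a <= Re z -> Cmod (Cinv z) <= 1.
Proof.
intros Hz; rewrite Cmod_inv by now apply halfplane_nz.
rewrite <- Rinv_1; apply Rinv_le_contravar; [lra|now apply Cmod_ge_1].
Qed.

Lemma norm_cscal_le (c : C) (x : W) (r s : R) :
  Cmod c <= r -> norm x <= s -> norm (scal (c : C_AbsRing) x) <= r * s.
Proof.
intros Hc Hx; eapply Rle_trans; [apply (@norm_cscal W)|].
apply Rmult_le_compat; auto; [apply Cmod_ge_0|apply norm_ge_0].
Qed.

Lemma holomorphic_with_const (x : W) : holomorphic_with a (fun _ => x) (fun _ => zero).
Proof.
intros M; exists (norm x); intros z z' _ _ _ _.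
pose proof (norm_ge_0 x) as Hx.
repeat split; [lra| |].
- eapply Rle_trans; [right; apply (@norm_zero C_AbsRing W)|easy].
- match goal with |- norm ?u <= _ => replace u with (zero : W) by (vlin W; ring) end.
  eapply Rle_trans; [right; apply (@norm_zero C_AbsRing W)|].
  apply Rmult_le_pos; [easy|apply pow2_ge_0].
Qed.

(** With h = z' - z, the remainder of f(z) / z is the remainder of f divided by z', plus h^2 f(z) /
    (z^2 z'), minus h^2 f'(z) / (z z'). As 1/|z| and 1/|z'| are at most 1, each term is at most K
    |h|^2, whence 3 K. *)
Lemma holomorphic_with_Cinv (f f' : C -> W) :
  holomorphic_with a f f' ->
  holomorphic_with a (fun z => scal (Cinv z : C_AbsRing) (f z))
    (fun z => minus (scal (Cinv z : C_AbsRing) (f' z))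
                (scal (Cmult (Cinv z) (Cinv z) : C_AbsRing) (f z))).
Proof.
intros Hf M; destruct (Hf M) as [K HK].
exists (3 * K); intros z z' Hz Hz' HM HM'.
destruct (HK z z' Hz Hz' HM HM') as [H1 [H2 H3]].
assert (HK0 : 0 <= K) by (eapply Rle_trans; [|exact H1]; apply norm_ge_0).
pose proof (Cmod_Cinv_le_1 Hz) as I1; pose proof (Cmod_Cinv_le_1 Hz') as I2.
assert (I3 : Cmod (Cmult (Cinv z) (Cinv z)) <= 1).
{ rewrite Cmod_mult; pose proof (Cmod_ge_0 (Cinv z)); nra. }
assert (I4 : Cmod (Cmult (Cinv z) (Cinv z')) <= 1).
{ rewrite Cmod_mult; pose proof (Cmod_ge_0 (Cinv z)); pose proof (Cmod_ge_0 (Cinv z')); nra. }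
repeat split.
- eapply Rle_trans; [exact (norm_cscal_le I1 H1)|lra].
- eapply Rle_trans; [apply (@norm_triangle C_AbsRing W)|]; rewrite (@norm_opp C_AbsRing W).
  pose proof (norm_cscal_le I1 H2); pose proof (norm_cscal_le I3 H1); lra.
- set (h := Cminus z' z) in *.
  replace (minus _ _) with
   (plus (plus (scal (Cinv z' : C_AbsRing) (minus (minus (f z') (f z)) (scal (h : C_AbsRing) (f' z))))
      (scal (Cmult (Cmult h h) (Cmult (Cinv z) (Cmult (Cinv z) (Cinv z'))) : C_AbsRing) (f z)))
      (opp (scal (Cmult (Cmult h h) (Cmult (Cinv z) (Cinv z')) : C_AbsRing) (f' z)))).
  2: { vlin W; unfold h; field; split; eapply halfplane_nz; eassumption. }
  eapply Rle_trans; [apply (@norm_triangle C_AbsRing W)|]; rewrite (@norm_opp C_AbsRing W).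
  eapply Rle_trans; [apply Rplus_le_compat_r, (@norm_triangle C_AbsRing W)|].
  pose proof (norm_cscal_le I2 H3) as G1.
  assert (Hh : 0 <= Cmod h) by apply Cmod_ge_0.
  assert (J2 : Cmod (Cmult (Cmult h h) (Cmult (Cinv z) (Cinv z'))) <= Cmod h ^ 2).
  { rewrite Cmod_mult, (Cmod_mult h h).
    replace (Cmod h ^ 2) with (Cmod h * Cmod h * 1) by ring.
    apply Rmult_le_compat_l; [nra|easy]. }
  assert (J1 : Cmod (Cmult (Cmult h h) (Cmult (Cinv z) (Cmult (Cinv z) (Cinv z')))) <= Cmod h ^ 2).
  { rewrite Cmod_mult, (Cmod_mult h h), (Cmod_mult (Cinv z)).
    replace (Cmod h ^ 2) with (Cmod h * Cmod h * (1 * 1)) by ring.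
    apply Rmult_le_compat_l; [nra|].
    apply Rmult_le_compat; auto; apply Cmod_ge_0. }
  pose proof (norm_cscal_le J1 H1); pose proof (norm_cscal_le J2 H2).
  lra.
Qed.

Lemma holomorphic_with_Cinv_pow (f f' : C -> W) (k : nat) :
  holomorphic_with a f f' ->
  exists g', holomorphic_with a (fun z => scal (Cpow (Cinv z) k : C_AbsRing) (f z)) g'.
Proof.
intros Hf; induction k as [|k [g' IH]].
- exists f'; intros M; destruct (Hf M) as [K HK]; exists K; intros z z'.
  replace (scal (Cpow (Cinv z) 0 : C_AbsRing) (f z)) with (f z) by (vlin W; simpl; ring).
  replace (scal (Cpow (Cinv z') 0 : C_AbsRing) (f z')) with (f z') by (vlin W; simpl; ring).
  apply HK.
- eexists; intros M; destruct (holomorphic_with_Cinv IH M) as [K HK]; exists K; intros z z'.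
  replace (scal (Cpow (Cinv z) (S k) : C_AbsRing) (f z)) with
    (scal (Cinv z : C_AbsRing) (scal (Cpow (Cinv z) k : C_AbsRing) (f z)))
    by (vlin W; simpl; ring).
  replace (scal (Cpow (Cinv z') (S k) : C_AbsRing) (f z')) with
    (scal (Cinv z' : C_AbsRing) (scal (Cpow (Cinv z') k : C_AbsRing) (f z')))
    by (vlin W; simpl; ring).
  apply HK.
Qed.

Lemma norm_Cinv_pow (z : C) (k : nat) : a <= Re z -> Cmod (Cpow (Cinv z) k) = / Cmod z ^ k.
Proof.
intros Hz; rewrite Cmod_pow, Cmod_inv by now apply halfplane_nz.
apply pow_inv.
Qed.

(** The exponents start at 2: for 1 / z the symmetric integrals over the line tend to PI, not to
    0. *)
Lemma pv_Cinv_pow (x : W) (k : nat) (b : R) : a < b ->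
  integrable_bound (fun s => scal (Cpow (Cinv (b, s)) (k + 2) : C_AbsRing) x : V) (norm x) /\
  pv (fun s => scal (Cpow (Cinv (b, s)) (k + 2) : C_AbsRing) x : V) = zero.
Proof.
intros Hb.
destruct (holomorphic_with_Cinv_pow (k + 2) (holomorphic_with_const x)) as [g' Hg].
assert (Hd : forall z, a <= Re z ->
  norm (scal (Cpow (Cinv z) (k + 2) : C_AbsRing) x) <= norm x / Cmod z ^ 2).
{ intros z Hz; eapply Rle_trans; [apply (@norm_cscal W)|].
  rewrite norm_Cinv_pow by easy; unfold Rdiv; rewrite Rmult_comm.
  apply Rmult_le_compat_l; [apply norm_ge_0|].
  pose proof (Cmod_ge_1 Hz).
  apply Rinv_le_contravar; [nra|]; apply Rle_pow; [easy|lia]. }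
split.
- apply (integrable_bound_vertical Hg a_ge_1 Hd); lra.
- apply (pv_vertical Hg a_ge_1 Hd Hb).
Qed.

Lemma distance_ratio (lam : R) (z : C) : Re z < lam ->
  Cmod z <= (Rabs lam / (lam - Re z) + 1) * Cmod (Cminus (RtoC lam) z).
Proof.
intros Hz.
assert (H1 : Cmod z <= Rabs lam + Cmod (Cminus (RtoC lam) z)).
{ replace z with (Cminus (RtoC lam) (Cminus (RtoC lam) z)) at 1 by ring.
  eapply Rle_trans; [apply Cmod_triangle|]; rewrite Cmod_opp, Cmod_R; lra. }
assert (H2 : lam - Re z <= Cmod (Cminus (RtoC lam) z)).
{ eapply Rle_trans; [apply Rle_abs|exact (Re_le_Cmod (Cminus (RtoC lam) z))]. }
assert (H3 : Rabs lam <= Rabs lam / (lam - Re z) * Cmod (Cminus (RtoC lam) z)).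
{ replace (Rabs lam) with (Rabs lam / (lam - Re z) * (lam - Re z)) at 1 by (field; lra).
  apply Rmult_le_compat_l; [|easy].
  apply Rdiv_le_0_compat; [apply Rabs_pos|lra]. }
lra.
Qed.

End HolomorphicExamples.

(** * The Cauchy kernel *)

Section CauchyKernel.
Variable W : CompleteNormedModule C_AbsRing.
Let V := realification W.
Variables a b lam : R.
Hypothesis a_ge_1 : 1 <= a.
Hypothesis a_lt_b : a < b.
Hypothesis b_lt_lam : b < lam.

Definition kernel (s : R) : C := Cinv (Cminus (RtoC lam) (b, s)).
(** The factor of [distance_ratio] on the line Re z = b, for positive lam. *)
Definition kernel_bound : R := lam / (lam - b) + 1.

Lemma kernel_bound_ge_0 : 0 <= kernel_bound.
Proof. assert (0 <= lam / (lam - b)) by (apply Rdiv_le_0_compat; lra); unfold kernel_bound; lra. Qed.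

Lemma kernel_nz (s : R) : Cminus (RtoC lam) (b, s) <> RtoC 0.
Proof. intros E; apply (f_equal fst) in E; simpl in E; lra. Qed.

Lemma Cmod_kernel (s : R) : Cmod (kernel s) <= kernel_bound * / Cmod (b, s).
Proof.
unfold kernel; rewrite Cmod_inv by apply kernel_nz.
pose proof (@distance_ratio lam (b, s) b_lt_lam) as H; simpl in H.
rewrite Rabs_pos_eq in H by lra; fold kernel_bound in H.
assert (H1 : 1 <= Cmod (b, s)) by (apply (Cmod_ge_1 a_ge_1); simpl; lra).
assert (H2 : 0 < Cmod (Cminus (RtoC lam) (b, s))) by (apply Cmod_gt_0, kernel_nz).
apply (Rmult_le_reg_r (Cmod (Cminus (RtoC lam) (b, s)))); [easy|].
rewrite Rinv_l by lra.
apply (Rmult_le_reg_r (Cmod (b, s))); [lra|].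
replace (kernel_bound * / Cmod (b, s) * Cmod (Cminus (RtoC lam) (b, s)) * Cmod (b, s))
  with (kernel_bound * Cmod (Cminus (RtoC lam) (b, s))) by (field; lra).
lra.
Qed.

Lemma kernel_parts (s : R) :
  kernel s = ((lam - b) / ((lam - b) ^ 2 + s ^ 2), s / ((lam - b) ^ 2 + s ^ 2)).
Proof.
unfold kernel, Cinv; apply injective_projections; simpl; field; nra.
Qed.

Lemma continuous_kernel (f : R -> W) (s : R) :
  continuous f s -> continuous (fun s => scal (kernel s : C_AbsRing) (f s)) s.
Proof.
intros Hf.
apply (continuous_ext (fun s => scal (((lam - b) / ((lam - b) ^ 2 + s ^ 2),
  s / ((lam - b) ^ 2 + s ^ 2)) : C_AbsRing) (f s))).
{ intros r; now rewrite kernel_parts. }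
apply (continuous_cscal (u := fun s => (lam - b) / ((lam - b) ^ 2 + s ^ 2))
  (v := fun s => s / ((lam - b) ^ 2 + s ^ 2))); [| |easy].
- apply (ex_derive_continuous (fun s => (lam - b) / ((lam - b) ^ 2 + s ^ 2))).
  auto_derive; nra.
- apply (ex_derive_continuous (fun s => s / ((lam - b) ^ 2 + s ^ 2))).
  auto_derive; nra.
Qed.

(** Decay of order one in f is enough, since the kernel contributes the second order. *)
Lemma integrable_bound_kernel (f : R -> W) (D : R) :
  (forall s, continuous f s) -> (forall s, norm (f s) <= D / Cmod (b, s)) ->
  integrable_bound (fun s => scal (kernel s : C_AbsRing) (f s) : V) (kernel_bound * D).
Proof.
intros Hc Hb; split; intros s.
- now apply continuous_kernel.
- eapply Rle_trans; [exact (norm_cscal_le (Cmod_kernel s) (Hb s))|].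
  assert (H1 : 1 <= Cmod (b, s)) by (apply (Cmod_ge_1 a_ge_1); simpl; lra).
  assert (HD : 0 <= D).
  { pose proof (norm_ge_0 (f s)); specialize (Hb s).
    assert (Hm : 0 <= D / Cmod (b, s)) by lra.
    apply (Rmult_le_compat_r (Cmod (b, s))) in Hm; [|lra].
    unfold Rdiv in Hm; rewrite Rmult_assoc, Rinv_l in Hm; lra. }
  pose proof kernel_bound_ge_0.
  replace (kernel_bound * / Cmod (b, s) * (D / Cmod (b, s))) with
    (kernel_bound * D / Cmod (b, s) ^ 2) by (field; lra).
  rewrite Cmod_vertical_sq.
  apply Rmult_le_compat_l; [nra|].
  apply Rinv_le_contravar; nra.
Qed.

Lemma continuous_Cinv_pow (x : W) (k : nat) (s : R) :
  continuous (fun s => scal (Cpow (Cinv (b, s)) k : C_AbsRing) x) s.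
Proof.
destruct (holomorphic_with_Cinv_pow a_ge_1 k (holomorphic_with_const a x)) as [g' Hg].
apply (continuous_vertical Hg); lra.
Qed.

Lemma norm_Cinv_pow_vec (x : W) (k : nat) (s : R) :
  norm (scal (Cpow (Cinv (b, s)) (S k) : C_AbsRing) x) <= norm x / Cmod (b, s).
Proof.
assert (H1 : 1 <= Cmod (b, s)) by (apply (Cmod_ge_1 a_ge_1); simpl; lra).
eapply Rle_trans; [apply (@norm_cscal W)|].
rewrite (norm_Cinv_pow a_ge_1) by (simpl; lra).
unfold Rdiv; rewrite Rmult_comm; apply Rmult_le_compat_l; [apply norm_ge_0|].
apply Rinv_le_contravar; [lra|].
rewrite <- (pow_1 (Cmod (b, s))) at 1; apply Rle_pow; [easy|lia].
Qed.

Lemma integrable_bound_kernel_pow (x : W) (k : nat) :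
  integrable_bound (fun s => scal (kernel s : C_AbsRing)
    (scal (Cpow (Cinv (b, s)) (S k) : C_AbsRing) x) : V) (kernel_bound * norm x).
Proof.
apply integrable_bound_kernel; intros s.
- apply continuous_Cinv_pow.
- apply norm_Cinv_pow_vec.
Qed.

Lemma RInt_kernel (x : W) (L : R) :
  RInt (fun s => scal (kernel s : C_AbsRing) (scal (Cpow (Cinv (b, s)) 1 : C_AbsRing) x) : V) (- L) L
  = scal (RtoC (2 / lam * (atan (L / b) + atan (L / (lam - b)))) : C_AbsRing) x.
Proof.
(* Real and imaginary parts of a primitive of (1 / z + 1 / (lam - z)) / lam. *)
set (u := fun s => / lam * (atan (s / b) + atan (s / (lam - b)))).
set (v := fun s => / lam * / 2 * (ln ((lam - b) ^ 2 + s ^ 2) - ln (b ^ 2 + s ^ 2))).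
set (u' := fun s => / lam * (b / (b ^ 2 + s ^ 2) + (lam - b) / ((lam - b) ^ 2 + s ^ 2))).
set (v' := fun s => / lam * (s / ((lam - b) ^ 2 + s ^ 2) - s / (b ^ 2 + s ^ 2))).
apply (@is_RInt_unique V).
apply (@is_RInt_ext V (fun s => scal ((u' s, v' s) : C_AbsRing) x)).
{ intros s _; vlin W; rewrite kernel_parts; unfold u', v'.
  apply injective_projections; simpl; field; repeat split; nra. }
replace (scal (RtoC (2 / lam * (atan (L / b) + atan (L / (lam - b)))) : C_AbsRing) x) with
  (minus (scal ((u L, v L) : C_AbsRing) x) (scal ((u (- L), v (- L)) : C_AbsRing) x)).
2:{ vlin W; unfold u, v.
  replace (- L / b) with (- (L / b)) by (field; lra).
  replace (- L / (lam - b)) with (- (L / (lam - b))) by (field; lra).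
  rewrite !atan_opp; replace ((- L) ^ 2) with (L ^ 2) by ring.
  apply injective_projections; simpl; field; lra. }
apply (@is_RInt_derive V (fun s => scal ((u s, v s) : C_AbsRing) x)); intros s _.
- apply is_derive_cscal.
  + unfold u, u'; auto_derive; [easy|]; field; repeat split; nra.
  + unfold v, v'; auto_derive; [repeat split; nra|]; field; repeat split; nra.
- apply (continuous_cscal (u := u') (v := v')).
  + apply (ex_derive_continuous u'); unfold u'; auto_derive; repeat split; nra.
  + apply (ex_derive_continuous v'); unfold v'; auto_derive; repeat split; nra.
  + apply continuous_const.
Qed.

(** The base case of the recursion in the exponent: 1 / (z (lam - z)) is absolutely integrable on
    the line while its two partial fractions are not, so it is evaluated through an explicit
    primitive, in which both arctangents tend to PI / 2. *)
Lemma pv_kernel_1 (x : W) :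
  pv (fun s => scal (kernel s : C_AbsRing) (scal (Cpow (Cinv (b, s)) 1 : C_AbsRing) x) : V)
  = scal (RtoC (2 * PI / lam) : C_AbsRing) x.
Proof.
apply (pv_unique (integrable_bound_kernel_pow x 0)).
apply filterlim_locally; intros eps.
pose proof (norm_ge_0 x) as Hx.
assert (He : 0 < eps * lam / (4 * (norm x + 1))).
{ apply Rdiv_lt_0_compat; [|lra]; apply Rmult_lt_0_compat; [apply cond_pos|lra]. }
destruct (atan_lim He) as [M [HM0 HM]].
(* Both L / b and L / (lam - b) exceed M beyond this threshold. *)
exists (M * b + M * (lam - b)); intros L HL.
apply (@norm_compat1 C_AbsRing W); rewrite RInt_kernel.
set (e1 := PI / 2 - atan (L / b)); set (e2 := PI / 2 - atan (L / (lam - b))).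
replace (minus _ _) with (scal (RtoC (- (2 / lam * (e1 + e2))) : C_AbsRing) x).
2:{ vlin W; unfold e1, e2; apply injective_projections; simpl; field; lra. }
assert (H1 : e1 < eps * lam / (4 * (norm x + 1))).
{ apply HM, (Rmult_lt_reg_r b); [lra|]; replace (L / b * b) with L by (field; lra); nra. }
assert (H2 : e2 < eps * lam / (4 * (norm x + 1))).
{ apply HM, (Rmult_lt_reg_r (lam - b)); [lra|].
  replace (L / (lam - b) * (lam - b)) with L by (field; lra); nra. }
assert (H3 : 0 <= e1 + e2).
{ pose proof (atan_bound (L / b)); pose proof (atan_bound (L / (lam - b))); unfold e1, e2; lra. }
eapply Rle_lt_trans; [apply (@norm_cscal W)|].
assert (Hl : 0 < / lam) by (apply Rinv_0_lt_compat; lra).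
rewrite Cmod_R, Rabs_Ropp, Rabs_pos_eq.
2:{ apply Rmult_le_pos; [unfold Rdiv; lra|easy]. }
apply Rle_lt_trans with (2 / lam * (e1 + e2) * (norm x + 1)).
- apply Rmult_le_compat_l; [|lra]; apply Rmult_le_pos; [unfold Rdiv; lra|easy].
- replace (pos eps) with (2 / lam * (2 * (eps * lam / (4 * (norm x + 1)))) * (norm x + 1)) by (field; lra).
  apply Rmult_lt_compat_r; [lra|]; apply Rmult_lt_compat_l; [unfold Rdiv; lra|]; lra.
Qed.

(* Recursion from 1 / (z^{k+1} (lam - z)) = (1 / z^{k+1} + 1 / (z^k (lam - z))) / lam. *)
Lemma pv_kernel_pow (x : W) (k : nat) :
  pv (fun s => scal (kernel s : C_AbsRing) (scal (Cpow (Cinv (b, s)) (S k) : C_AbsRing) x) : V)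
  = scal (RtoC (2 * PI * / lam ^ (S k)) : C_AbsRing) x.
Proof.
induction k as [|k IH].
- rewrite pv_kernel_1; vlin W; apply injective_projections; simpl; field; lra.
- destruct (pv_Cinv_pow a_ge_1 x k a_lt_b) as [Hp1 Hp2].
  replace (k + 2)%nat with (S (S k)) in * by lia.
  pose proof (integrable_bound_kernel_pow x k) as Hp3.
  etransitivity.
  { apply (@pv_ext V _ (fun s => scal (RtoC (/ lam) : C_AbsRing)
    (plus (scal (Cpow (Cinv (b, s)) (S (S k)) : C_AbsRing) x : V)
       (scal (kernel s : C_AbsRing) (scal (Cpow (Cinv (b, s)) (S k) : C_AbsRing) x) : V) : W))
    (Cmod (RtoC (/ lam)) * (norm x + kernel_bound * norm x))).
    2: exact (integrable_bound_cscal (RtoC (/ lam)) (integrable_bound_plus Hp1 Hp3)).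
    intros s; vlin W; unfold kernel.
    rewrite RtoC_inv by lra.
    change (Cpow (Cinv (b, s)) (S (S k))) with (Cmult (Cinv (b, s)) (Cpow (Cinv (b, s)) (S k))).
    set (c := Cpow (Cinv (b, s)) (S k)).
    field; repeat split.
    - apply kernel_nz.
    - apply (halfplane_nz a_ge_1); simpl; lra.
    - intros E; apply (f_equal fst) in E; simpl in E; lra. }
  etransitivity; [exact (pv_cscal (RtoC (/ lam)) (integrable_bound_plus Hp1 Hp3))|].
  etransitivity; [apply f_equal; exact (pv_plus Hp1 Hp3)|].
  etransitivity; [apply f_equal, (f_equal2 plus); [exact Hp2|exact IH]|].
  vlin W; apply injective_projections; simpl; field; split; try lra; apply pow_nonzero; lra.
Qed.

End CauchyKernel.

(** * Inverse Laplace transform of the scaled resolvent *)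

Section LaplaceInversion.
Variable W : CompleteNormedModule C_AbsRing.
Let V := realification W.
Variables a b K : R.
Variable p : nat.
Variable Rz : C -> bounded_op W W.
Hypothesis a_ge_1 : 1 <= a.
Hypothesis a_lt_b : a < b.
Hypothesis K_ge_0 : 0 <= K.
Hypothesis Rz_identity : forall z z' w, a <= Re z -> a <= Re z' ->
  Rz z' w = plus (Rz z w) (scal (Cminus z z' : C_AbsRing) (Rz z (Rz z' w))).
Hypothesis Rz_growth : forall z w, a <= Re z ->
  norm (Rz z w) <= K * (Cmod z ^ p / Cmod z) * norm w.

(** With h = z' - z, two uses of the resolvent identity give R(z') = R(z) - h R(z)^2 + h^2 R(z)^2
    R(z'). The last term is the remainder, and local boundedness of R makes it uniformly
    quadratic. *)
Lemma holomorphic_with_resolvent (w : W) :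
  holomorphic_with a (fun z => Rz z w) (fun z => opp (Rz z (Rz z w))).
Proof.
intros M.
(* A bound for R on |z| <= M: as |z| >= 1, the quotient |z|^p / |z| is at most |z|^p, also when p =
   0. *)
set (B := K * Rabs M ^ p).
assert (HB : 0 <= B) by (apply Rmult_le_pos; [easy|apply pow_le, Rabs_pos]).
assert (Hb : forall z w, a <= Re z -> Cmod z <= M -> norm (Rz z w) <= B * norm w).
{ intros z v Hz HM; eapply Rle_trans; [now apply Rz_growth|].
  apply Rmult_le_compat_r; [apply norm_ge_0|]; apply Rmult_le_compat_l; [easy|].
  pose proof (Cmod_ge_1 a_ge_1 Hz) as H1; pose proof (Rle_abs M).
  assert (Hi : / Cmod z <= 1) by (rewrite <- Rinv_1; apply Rinv_le_contravar; lra).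
  assert (0 <= Cmod z ^ p) by (apply pow_le; lra).
  assert (Cmod z ^ p <= Rabs M ^ p) by (apply pow_incr; lra).
  unfold Rdiv; nra. }
set (n := norm w).
assert (Hn : 0 <= n) by apply norm_ge_0.
(* The summands bound one, two and three resolvents applied to w, as they occur in the value, the
   derivative and the remainder. *)
exists (B * n + B * (B * n) + B * (B * (B * n))).
assert (P1 : 0 <= B * n) by nra.
assert (P2 : 0 <= B * (B * n)) by nra.
assert (P3 : 0 <= B * (B * (B * n))) by nra.
intros z z' Hz Hz' HM HM'.
repeat split.
- pose proof (Hb z w Hz HM); unfold n in *; lra.
- rewrite (@norm_opp C_AbsRing W).
  pose proof (Hb z (Rz z w) Hz HM); pose proof (Hb z w Hz HM); unfold n in *; nra.
- set (h := Cminus z' z).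
  replace (minus _ _) with (scal (Cmult h h : C_AbsRing) (Rz z (Rz z (Rz z' w)))).
  + eapply Rle_trans; [apply (@norm_cscal W)|].
    rewrite Cmod_mult.
    assert (norm (Rz z (Rz z (Rz z' w))) <= B * (B * (B * n))).
    { eapply Rle_trans; [now apply Hb|]; apply Rmult_le_compat_l; [easy|].
      eapply Rle_trans; [now apply Hb|]; apply Rmult_le_compat_l; [easy|].
      now apply Hb. }
    pose proof (Cmod_ge_0 h).
    replace (Cmod h * Cmod h) with (Cmod h ^ 2) by ring.
    rewrite Rmult_comm; apply Rmult_le_compat_r; [apply pow2_ge_0|lra].
  + assert (E : Rz z (Rz z' w) = plus (Rz z (Rz z w)) (scal (Cminus z z' : C_AbsRing)
      (Rz z (Rz z (Rz z' w))))).
    { rewrite (Rz_identity w Hz Hz') at 1.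
      rewrite (linear_plus _ (bop_linear (Rz z))), (linear_scal _ (bop_linear (Rz z))); reflexivity. }
    rewrite (Rz_identity w Hz Hz') at 2.
    rewrite E at 2.
    vlin W; unfold h; ring.
Qed.

Definition scaled_resolvent (w : W) (z : C) : W :=
  scal (Cpow (Cinv z) (p + 2) : C_AbsRing) (Rz z w).

Lemma scaled_resolvent_cube (w : W) (z : C) : a <= Re z ->
  norm (scaled_resolvent w z) <= K * norm w / Cmod z ^ 3.
Proof.
intros Hz; unfold scaled_resolvent.
pose proof (Cmod_ge_1 a_ge_1 Hz) as H1.
eapply Rle_trans; [apply (@norm_cscal_le W _ _ (/ Cmod z ^ (p + 2))); [|now apply Rz_growth]|].
- right; now apply (norm_Cinv_pow a_ge_1).
- right; rewrite pow_add; field; repeat split; try apply pow_nonzero; lra.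
Qed.

Lemma scaled_resolvent_decay (w : W) (z : C) : a <= Re z ->
  norm (scaled_resolvent w z) <= K * norm w / Cmod z ^ 2.
Proof.
intros Hz; eapply Rle_trans; [now apply scaled_resolvent_cube|].
pose proof (Cmod_ge_1 a_ge_1 Hz) as H1; pose proof (norm_ge_0 w).
apply Rmult_le_compat_l; [nra|].
apply Rinv_le_contravar; [nra|apply Rle_pow; [easy|lia]].
Qed.

Lemma continuous_scaled_resolvent (w : W) (s : R) :
  continuous (fun s => scaled_resolvent w (b, s)) s.
Proof.
destruct (holomorphic_with_Cinv_pow a_ge_1 (p + 2) (holomorphic_with_resolvent w)) as [g Hg].
apply (continuous_vertical Hg); lra.
Qed.

Lemma pv_scaled_resolvent (w : W) :
  integrable_bound (fun s => scaled_resolvent w (b, s) : V) (K * norm w) /\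
  pv (fun s => scaled_resolvent w (b, s) : V) = zero.
Proof.
destruct (holomorphic_with_Cinv_pow a_ge_1 (p + 2) (holomorphic_with_resolvent w)) as [g Hg].
split.
- apply (integrable_bound_vertical Hg a_ge_1 (@scaled_resolvent_decay w)); lra.
- apply (pv_vertical Hg a_ge_1 (@scaled_resolvent_decay w) a_lt_b).
Qed.

Lemma scaled_resolvent_vertical (w : W) (s : R) :
  norm (scaled_resolvent w (b, s)) <= K * norm w / (1 + s ^ 2).
Proof. apply (proj1 (pv_scaled_resolvent w)). Qed.

Lemma continuous_expC_scal (c t : R) (f : R -> W) (s : R) : continuous f s ->
  continuous (fun s => scal (expC (c, s) t : C_AbsRing) (f s)) s.
Proof.
intros Hf.
apply (continuous_cscal (u := fun s => exp (c * t) * cos (s * t))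
  (v := fun s => exp (c * t) * sin (s * t))); [| |easy].
- apply (ex_derive_continuous (fun s => exp (c * t) * cos (s * t))); now auto_derive.
- apply (ex_derive_continuous (fun s => exp (c * t) * sin (s * t))); now auto_derive.
Qed.

(** The abscissa c of the exponential is independent of the line Re z = b that carries the
    resolvent: c = b gives 2 PI S(t) w, and c = b - lam gives its product with e^{- lam t}. *)
Definition exp_integrand (c t : R) (w : W) (s : R) : V :=
  scal (expC (c, s) t : C_AbsRing) (scaled_resolvent w (b, s)).

Lemma integrable_bound_exp (c t : R) (w : W) :
  integrable_bound (exp_integrand c t w)
    (exp (c * t) * (K * norm w)).
Proof.
split; intros s.
- apply continuous_expC_scal, continuous_scaled_resolvent.
- unfold Rdiv; rewrite Rmult_assoc; apply (@norm_cscal_le W).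
  + right; apply (Cmod_expC (c, s) t).
  + apply scaled_resolvent_vertical.
Qed.

Lemma scaled_resolvent_plus (x y : W) (z : C) :
  scaled_resolvent (plus x y) z = plus (scaled_resolvent x z) (scaled_resolvent y z).
Proof.
unfold scaled_resolvent; rewrite (linear_plus _ (bop_linear (Rz z))).
vlin W; ring.
Qed.

Lemma scaled_resolvent_scal (c : C) (x : W) (z : C) :
  scaled_resolvent (scal (c : C_AbsRing) x) z = scal (c : C_AbsRing) (scaled_resolvent x z).
Proof.
unfold scaled_resolvent; rewrite (linear_scal _ (bop_linear (Rz z))).
vlin W; ring.
Qed.

Definition inverse_laplace (t : R) (w : W) : W :=
  scal (RtoC (/ (2 * PI)) : C_AbsRing)
    (pv (exp_integrand b t w) : W).

Lemma inverse_laplace_norm (t : R) (w : W) :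
  norm (inverse_laplace t w) <= K * exp (b * t) * norm w.
Proof.
pose proof PI_RGT_0 as HPI; pose proof (norm_ge_0 w); pose proof (exp_pos (b * t)).
eapply Rle_trans; [apply (@norm_cscal_le W _ _ (/ (2 * PI)))|].
- rewrite Cmod_R, Rabs_pos_eq; [lra|]; apply Rlt_le, Rinv_0_lt_compat; lra.
- exact (pv_norm (integrable_bound_exp b t w)).
- replace (/ (2 * PI) * (exp (b * t) * (K * norm w) * PI)) with (/ 2 * (K * exp (b * t) * norm w))
    by (field; lra).
  assert (0 <= K * exp (b * t) * norm w) by (apply Rmult_le_pos; nra); lra.
Qed.

Lemma inverse_laplace_linear (t : R) : @is_linear C_AbsRing W W (inverse_laplace t).
Proof.
split.
- intros x y.
  transitivity (scal (RtoC (/ (2 * PI)) : C_AbsRing) (plus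
    (pv (exp_integrand b t x) : W)
    (pv (exp_integrand b t y) : W))).
  2: unfold inverse_laplace; vlin W; ring.
  unfold inverse_laplace; apply f_equal.
  etransitivity; [|exact (pv_plus (integrable_bound_exp b t x) (integrable_bound_exp b t y))].
  refine (@pv_ext V _ _ _ _ (integrable_bound_plus (integrable_bound_exp b t x) (integrable_bound_exp b t y))).
  intros s; unfold exp_integrand; rewrite scaled_resolvent_plus; vlin W; ring.
- intros c x.
  transitivity (scal (RtoC (/ (2 * PI)) : C_AbsRing) (scal (c : C_AbsRing)
    (pv (exp_integrand b t x) : W))).
  2: unfold inverse_laplace; vlin W; ring.
  unfold inverse_laplace; apply f_equal.
  etransitivity; [|exact (pv_cscal c (integrable_bound_exp b t x))].
  refine (@pv_ext V _ _ _ _ (integrable_bound_cscal c (integrable_bound_exp b t x))).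
  intros s; unfold exp_integrand; rewrite (scaled_resolvent_scal c); vlin W; ring.
- exists (K * exp (b * t) + 1); split.
  + pose proof (exp_pos (b * t)); nra.
  + intros x; eapply Rle_trans; [apply inverse_laplace_norm|].
    pose proof (norm_ge_0 x); nra.
Qed.

Definition inverse_laplace_bop (t : R) : bounded_op W W :=
  Build_bounded_op (inverse_laplace_linear t).

Lemma exp_le_near (c t t' r : R) : Rabs (t' - t) < 1 -> Rmin t t' <= r <= Rmax t t' ->
  exp (c * r) <= exp (c * t + Rabs c).
Proof.
intros Ht Hr.
assert (H : Rabs (r - t) <= 1).
{ apply Rabs_def2 in Ht; apply Rabs_le; revert Hr; unfold Rmin, Rmax; destruct Rle_dec; lra. }
assert (H2 : c * (r - t) <= Rabs c).
{ eapply Rle_trans; [apply Rle_abs|]; rewrite Rabs_mult.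
  pose proof (Rabs_pos c); nra. }
destruct (Rle_lt_or_eq_dec (c * r) (c * t + Rabs c)) as [Hl|Hl]; [lra| |].
- left; now apply exp_increasing.
- right; now rewrite Hl.
Qed.

(** The increment of the exponential costs a factor |b + i s|; against the cube this leaves |b + i
    s|^{-2}, which is still integrable. *)
Lemma continuous_inverse_laplace (w : W) (t : R) : continuous (fun t => inverse_laplace t w) t.
Proof.
set (B := exp (b * t + Rabs b)).
apply (@continuous_lipschitz V _ _ (2 * B * (K * norm w))).
exists (mkposreal 1 Rlt_0_1); intros t' Ht'.
change (Rabs (t' - t) < 1) in Ht'.
pose proof (integrable_bound_minus (integrable_bound_exp b t' w) (integrable_bound_exp b t w)) as Hi.
assert (Hi2 : integrable_bound (fun s => minus
  (exp_integrand b t' w s)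
  (exp_integrand b t w s))
  (2 * B * Rabs (t' - t) * (K * norm w))).
{ apply (integrable_bound_weaken Hi); intros s.
  match goal with |- norm ?u <= _ => replace u with
    (scal (Cminus (expC (b, s) t') (expC (b, s) t) : C_AbsRing) (scaled_resolvent w (b, s)))
    by (unfold exp_integrand; vlin W; ring) end.
  assert (Hb : a <= Re (b, s)) by (simpl; lra).
  pose proof (Cmod_ge_1 a_ge_1 Hb) as H1.
  eapply Rle_trans.
  { apply (@norm_cscal_le W); [apply expC_lipschitz; intros r Hr; exact (@exp_le_near b t t' r Ht' Hr)|].
    now apply scaled_resolvent_cube. }
  fold B.
  replace (2 * (Cmod (b, s) * B) * Rabs (t' - t) * (K * norm w / Cmod (b, s) ^ 3)) with
    (2 * B * Rabs (t' - t) * (K * norm w) / Cmod (b, s) ^ 2) by (field; lra).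
  rewrite Cmod_vertical_sq.
  apply Rmult_le_compat_l.
  - pose proof (norm_ge_0 w); pose proof (Rabs_pos (t' - t)); pose proof (exp_pos (b * t + Rabs b)).
    fold B in H2; repeat apply Rmult_le_pos; lra.
  - apply Rinv_le_contravar; nra. }
match goal with |- norm ?u <= _ => replace u with
  (scal (RtoC (/ (2 * PI)) : C_AbsRing) (pv (fun s => minus
  (exp_integrand b t' w s)
  (exp_integrand b t w s)) : W)) end.
- pose proof PI_RGT_0 as HPI.
  eapply Rle_trans; [apply (@norm_cscal_le W _ _ (/ (2 * PI)))|].
  + rewrite Cmod_R, Rabs_pos_eq; [lra|]; apply Rlt_le, Rinv_0_lt_compat; lra.
  + exact (pv_norm Hi2).
  + pose proof (integrable_bound_ge_0 Hi2).
    replace (/ (2 * PI) * (2 * B * Rabs (t' - t) * (K * norm w) * PI)) with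
      (/ 2 * (2 * B * Rabs (t' - t) * (K * norm w))) by (field; lra).
    change (abs (t' - t)) with (Rabs (t' - t)). lra.
- etransitivity; [apply f_equal; exact (pv_minus (integrable_bound_exp b t' w) (integrable_bound_exp b t w))|].
  unfold inverse_laplace; vlin W; ring.
Qed.

(** * The Laplace transform at a real point beyond the line *)

Section LaplaceTransform.
Variables (lam : R) (w : W).
Hypothesis b_lt_lam : b < lam.
Let R_lam : W := Rz (RtoC lam) w.

Definition primitive_integrand (t s : R) : V :=
  scal (kernel b lam s : C_AbsRing)
    (exp_integrand (b - lam) t w s).

Lemma integrable_bound_primitive (t : R) :
  integrable_bound (primitive_integrand t)
    (kernel_bound b lam * (exp ((b - lam) * t) * (K * norm w))).
Proof.
apply (integrable_bound_kernel a_ge_1 a_lt_b b_lt_lam); intros s.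
- apply continuous_expC_scal, continuous_scaled_resolvent.
- assert (Hb : a <= Re (b, s)) by (simpl; lra).
  pose proof (Cmod_ge_1 a_ge_1 Hb) as H1; pose proof (norm_ge_0 w).
  unfold Rdiv; rewrite Rmult_assoc; apply (@norm_cscal_le W).
  + right; apply (Cmod_expC (b - lam, s) t).
  + eapply Rle_trans; [now apply scaled_resolvent_cube|].
    apply Rmult_le_compat_l; [nra|].
    apply Rinv_le_contravar; [lra|].
    rewrite <- (pow_1 (Cmod (b, s))) at 1; apply Rle_pow; [easy|lia].
Qed.

Lemma kernel_mult (s : R) : Cmult (kernel b lam s) (b - lam, s) = Copp (RtoC 1).
Proof.
replace ((b - lam, s) : C) with (Copp (Cminus (RtoC lam) (b, s)))
  by (apply injective_projections; simpl; ring).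
unfold kernel; field; now apply kernel_nz.
Qed.

(** The Taylor remainder of the exponential brings |z - lam|^2 <= (1 + lam)^2 |z|^2, while the
    kernel and the scaled resolvent bring |z|^{-1} and |z|^{-3}; the remaining |z|^{-2} is
    integrable. In the linear term the kernel cancels z - lam up to sign, by [kernel_mult]. *)
Lemma is_derive_primitive (t : R) :
  is_derive (fun t => pv (primitive_integrand t)) t
    (scal (Copp (RtoC 1) : C_AbsRing)
      (pv (exp_integrand (b - lam) t w) : W) : V).
Proof.
set (q := kernel_bound b lam).
set (B := exp ((b - lam) * t + Rabs (b - lam))).
apply (@is_derive_quadratic V _ _ _ (2 * q * B * (1 + lam) ^ 2 * (K * norm w) * PI)).
exists (mkposreal 1 Rlt_0_1); intros t' Ht'.
change (Rabs (t' - t) < 1) in Ht'.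
pose proof (integrable_bound_minus
  (integrable_bound_minus (integrable_bound_primitive t') (integrable_bound_primitive t))
  (integrable_bound_cscal (RtoC (- (t' - t))) (integrable_bound_exp (b - lam) t w))) as Hi.
pose proof (integrable_bound_minus (integrable_bound_primitive t') (integrable_bound_primitive t)) as Hi1.
assert (Hi2 : integrable_bound (fun s =>
  minus (minus (primitive_integrand t' s) (primitive_integrand t s))
    (scal (RtoC (- (t' - t)) : C_AbsRing)
       (exp_integrand (b - lam) t w s : W) : V))
  (2 * q * B * (1 + lam) ^ 2 * (K * norm w) * (t' - t) ^ 2)).
{ apply (integrable_bound_weaken Hi); intros s.
  assert (Hb : a <= Re (b, s)) by (simpl; lra).
  pose proof (Cmod_ge_1 a_ge_1 Hb) as H1; pose proof (norm_ge_0 w) as Hw.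
  match goal with |- norm ?u <= _ => replace u with
    (scal (kernel b lam s : C_AbsRing)
      (scal (Cminus (Cminus (expC (b - lam, s) t') (expC (b - lam, s) t))
         (Cmult (RtoC (t' - t)) (Cmult (b - lam, s) (expC (b - lam, s) t))) : C_AbsRing)
        (scaled_resolvent w (b, s)))) end.
  2:{ unfold primitive_integrand, exp_integrand; vlin W.
      match goal with |- ?l = ?r => transitivity (Cminus
        (Cmult (kernel b lam s) (Cminus (expC (b - lam, s) t') (expC (b - lam, s) t)))
        (Cmult (Cmult (kernel b lam s) (b - lam, s)) (Cmult (RtoC (t' - t)) (expC (b - lam, s) t)))) end.
      - ring.
      - rewrite kernel_mult, !RtoC_opp; ring. }
  assert (Hmu : Cmod (b - lam, s) <= (1 + lam) * Cmod (b, s)).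
  { replace ((b - lam, s) : C) with (Cminus (b, s) (RtoC lam))
      by (apply injective_projections; simpl; ring).
    eapply Rle_trans; [apply Cmod_triangle|]; rewrite Cmod_opp, Cmod_R, Rabs_pos_eq by lra.
    nra. }
  pose proof (Cmod_ge_0 (b - lam, s)) as Hmu0.
  assert (HB : 0 < B) by apply exp_pos.
  assert (Hq : 0 <= q) by (apply (kernel_bound_ge_0 a_ge_1 a_lt_b b_lt_lam)).
  eapply Rle_trans.
  { apply (@norm_cscal_le W); [exact (Cmod_kernel a_ge_1 a_lt_b b_lt_lam s)|].
    apply (@norm_cscal_le W);
      [apply expC_taylor2; intros r Hr; exact (@exp_le_near (b - lam) t t' r Ht' Hr)|].
    now apply scaled_resolvent_cube. }
  fold B q.
  apply Rle_trans with (q * / Cmod (b, s) * (2 * (((1 + lam) * Cmod (b, s)) ^ 2 * B) * (t' - t) ^ 2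
    * (K * norm w / Cmod (b, s) ^ 3))).
  - apply Rmult_le_compat_l.
    { apply Rmult_le_pos; [easy|]; apply Rlt_le, Rinv_0_lt_compat; lra. }
    apply Rmult_le_compat_r.
    { apply Rdiv_le_0_compat; [nra|]; apply pow_lt; lra. }
    apply Rmult_le_compat_r; [apply pow2_ge_0|].
    apply Rmult_le_compat_l; [lra|]; apply Rmult_le_compat_r; [lra|].
    apply pow_incr; lra.
  - replace (q * / Cmod (b, s) * (2 * (((1 + lam) * Cmod (b, s)) ^ 2 * B) * (t' - t) ^ 2
      * (K * norm w / Cmod (b, s) ^ 3))) with
      (2 * q * B * (1 + lam) ^ 2 * (K * norm w) * (t' - t) ^ 2 / Cmod (b, s) ^ 2) by (field; lra).
    rewrite Cmod_vertical_sq.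
    apply Rmult_le_compat_l; [|apply Rinv_le_contravar; nra].
    pose proof (pow2_ge_0 (1 + lam)); pose proof (pow2_ge_0 (t' - t)).
    apply Rmult_le_pos; [|easy].
    apply Rmult_le_pos; [apply Rmult_le_pos; [nra|easy]|nra]. }
match goal with |- norm ?u <= _ => replace u with (pv (fun s =>
  minus (minus (primitive_integrand t' s) (primitive_integrand t s))
    (scal (RtoC (- (t' - t)) : C_AbsRing)
       (exp_integrand (b - lam) t w s : W) : V))) end.
- replace (2 * q * B * (1 + lam) ^ 2 * (K * norm w) * PI * (t' - t) ^ 2) with
    (2 * q * B * (1 + lam) ^ 2 * (K * norm w) * (t' - t) ^ 2 * PI) by ring.
  exact (pv_norm Hi2).
- etransitivity; [exact (pv_minus Hi1 (integrable_bound_cscal (RtoC (- (t' - t))) (integrable_bound_exp (b - lam) t w)))|].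
  etransitivity; [apply (f_equal2 minus);
    [exact (pv_minus (integrable_bound_primitive t') (integrable_bound_primitive t))
    |exact (pv_cscal (RtoC (- (t' - t))) (integrable_bound_exp (b - lam) t w))]|].
  fold V; vlin W; rewrite ?RtoC_opp; ring.
Qed.

Lemma pv_exp_shift (t : R) :
  pv (exp_integrand (b - lam) t w) =
  scal (RtoC (exp (- (lam * t)) * (2 * PI)) : C_AbsRing) (inverse_laplace t w).
Proof.
etransitivity.
{ refine (@pv_ext V _ _ _ _ (integrable_bound_cscal (RtoC (exp (- (lam * t)))) (integrable_bound_exp b t w))).
  intros s; unfold exp_integrand; rewrite <- expC_shift; vlin W; ring. }
etransitivity; [exact (pv_cscal (RtoC (exp (- (lam * t)))) (integrable_bound_exp b t w))|].
unfold inverse_laplace; fold V; vlin W.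
pose proof PI_RGT_0; apply injective_projections; simpl; field; lra.
Qed.

Lemma pv_primitive_0 :
  pv (primitive_integrand 0) = scal (RtoC (2 * PI * / lam ^ (p + 2)) : C_AbsRing) R_lam.
Proof.
replace (p + 2)%nat with (S (p + 1)) by lia.
destruct (pv_scaled_resolvent R_lam) as [H1 H2].
pose proof (integrable_bound_kernel_pow a_ge_1 a_lt_b b_lt_lam R_lam (p + 1)) as H3.
etransitivity.
{ refine (@pv_ext V _ _ _ _ (integrable_bound_plus H3 H1)).
  intros s; unfold primitive_integrand, exp_integrand; rewrite expC_0.
  unfold scaled_resolvent; replace (p + 2)%nat with (S (p + 1)) by lia.
  assert (E : Rz (b, s) w = plus R_lam (scal (Cminus (RtoC lam) (b, s) : C_AbsRing) (Rz (b, s) R_lam))).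
  { unfold R_lam.
    rewrite (@Rz_identity (b, s) (RtoC lam) w) at 1 by (simpl; lra).
    vlin W; ring. }
  rewrite E; vlin W.
  - unfold kernel; field; now apply kernel_nz.
  - ring. }
etransitivity; [exact (pv_plus H3 H1)|].
etransitivity; [apply (f_equal2 plus);
  [exact (pv_kernel_pow a_ge_1 a_lt_b b_lt_lam R_lam (p + 1))|exact H2]|].
vlin W; ring.
Qed.

Lemma is_RInt_inverse_laplace (T : R) :
  is_RInt (fun t => scal (exp (- (lam * t))) (inverse_laplace t w : V)) 0 T
    (minus (scal (RtoC (/ lam ^ (p + 2)) : C_AbsRing) R_lam)
       (scal (RtoC (/ (2 * PI)) : C_AbsRing) (pv (primitive_integrand T) : W)) : V).
Proof.
pose proof PI_RGT_0 as HPI.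
set (Psi := fun t => scal (- / (2 * PI)) (pv (primitive_integrand t))).
replace (minus (scal (RtoC (/ lam ^ (p + 2)) : C_AbsRing) R_lam)
   (scal (RtoC (/ (2 * PI)) : C_AbsRing) (pv (primitive_integrand T) : W)) : V)
  with (minus (Psi T) (Psi 0)).
2:{ unfold Psi; rewrite pv_primitive_0.
    assert (lam ^ (p + 2) <> 0) by (apply pow_nonzero; lra).
    vlin W; apply injective_projections; simpl; field; lra. }
apply (@is_RInt_derive V Psi); intros t _.
- replace (scal (exp (- (lam * t))) (inverse_laplace t w : V)) with
    (scal (- / (2 * PI)) (scal (Copp (RtoC 1) : C_AbsRing)
      (pv (exp_integrand (b - lam) t w) : W) : V)).
  + eapply filterdiff_ext_lin.
    * apply (@filterdiff_scal_r_fct R_AbsRing R_NormedModule V _ _ (- / (2 * PI)));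
        [apply Rmult_comm|apply is_derive_primitive].
    * intros y; cbv beta; vlin W; ring.
  + rewrite pv_exp_shift; vlin W; apply injective_projections; simpl; field; lra.
- apply (@continuous_scal _ R_AbsRing V (fun t => exp (- (lam * t))) (fun t => inverse_laplace t w)).
  + apply (ex_derive_continuous (fun t => exp (- (lam * t)))); now auto_derive.
  + apply continuous_inverse_laplace.
Qed.

Lemma is_RInt_gen_inverse_laplace :
  is_RInt_gen (fun t => scal (exp (- (lam * t))) (inverse_laplace t w : V))
    (at_point 0) (Rbar_locally p_infty) (scal (/ lam ^ (p + 2)) (R_lam : V)).
Proof.
pose proof PI_RGT_0 as HPI.
pose proof (norm_ge_0 w) as Hw.
pose proof (kernel_bound_ge_0 a_ge_1 a_lt_b b_lt_lam) as Hq.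
intros P [eps HP].
set (D := kernel_bound b lam * (K * norm w)).
assert (HD : 0 <= D) by (apply Rmult_le_pos; nra).
assert (He : 0 < eps / (D + 1)) by (apply Rdiv_lt_0_compat; [apply cond_pos|lra]).
(* As b - lam is negative, this threshold on T says exactly that e^{(b - lam) T} < eps / (D + 1). *)
apply (Filter_prod _ _ _ (fun x => x = 0) (fun T => ln (eps / (D + 1)) / (b - lam) < T)).
- easy.
- eexists; intros T HT; exact HT.
- intros x T -> HT; eexists; split; [apply is_RInt_inverse_laplace|].
  apply HP, (@norm_compat1 R_AbsRing V).
  match goal with |- norm ?u < _ => replace u with
    (scal (RtoC (- / (2 * PI)) : C_AbsRing) (pv (primitive_integrand T) : W)) end.
  2:{ cbn [snd]; vlin W; apply injective_projections; simpl; ring. }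
  assert (Hx : exp ((b - lam) * T) < eps / (D + 1)).
  { rewrite <- (exp_ln _ He); apply exp_increasing.
    apply (Rmult_lt_gt_compat_neg_l (b - lam)) in HT; [|lra].
    replace ((b - lam) * (ln (eps / (D + 1)) / (b - lam))) with (ln (eps / (D + 1))) in HT by (field; lra).
    lra. }
  eapply Rle_lt_trans.
  { apply (@norm_cscal_le W _ _ (/ (2 * PI))).
    - rewrite Cmod_R, Rabs_Ropp, Rabs_pos_eq; [lra|]; apply Rlt_le, Rinv_0_lt_compat; lra.
    - exact (pv_norm (integrable_bound_primitive T)). }
  replace (/ (2 * PI) * (kernel_bound b lam * (exp ((b - lam) * T) * (K * norm w)) * PI)) with
    (/ 2 * (D * exp ((b - lam) * T))) by (unfold D; field; lra).
  pose proof (exp_pos ((b - lam) * T)).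
  apply Rle_lt_trans with (D * exp ((b - lam) * T)); [nra|].
  apply Rle_lt_trans with ((D + 1) * exp ((b - lam) * T)); [nra|].
  replace (pos eps) with ((D + 1) * (eps / (D + 1))) by (field; lra).
  apply Rmult_lt_compat_l; lra.
Qed.

End LaplaceTransform.
End LaplaceInversion.

(** * Transfer through the Weierstrass form *)

Lemma opnorm_bound (U V : NormedModule C_AbsRing) (T : bounded_op U V) (r : R) :
  Rbar_le (opnorm T) r -> forall x, norm (T x) <= r * norm x.
Proof.
intros Hr x.
destruct (Lub_Rbar_correct (fun r => exists x : U, norm x <= 1 /\ r = norm (T x))) as [Hub _].
destruct (Req_dec (norm x) 0) as [E|E].
- rewrite (norm_eq_zero _ E), (linear_zero _ (bop_linear T)), !norm_zero; lra.
- pose proof (norm_ge_0 x).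
  set (c := RtoC (/ norm x)).
  assert (Hc : Cmod c = / norm x).
  { unfold c; rewrite Cmod_R; apply Rabs_pos_eq, Rlt_le, Rinv_0_lt_compat; lra. }
  assert (H1 : norm (T (scal (c : C_AbsRing) x)) <= r).
  { apply (Rbar_le_trans (norm (T (scal (c : C_AbsRing) x))) (opnorm T) r); [|exact Hr].
    apply Hub; exists (scal (c : C_AbsRing) x); split; [|easy].
    eapply Rle_trans; [apply (norm_scal (c : C_AbsRing))|].
    change (abs (c : C_AbsRing)) with (Cmod c); rewrite Hc, Rinv_l by lra; lra. }
  replace (T x) with (scal (RtoC (norm x) : C_AbsRing) (T (scal (c : C_AbsRing) x))).
  + eapply Rle_trans; [apply (norm_scal (RtoC (norm x) : C_AbsRing))|].
    change (abs (RtoC (norm x) : C_AbsRing)) with (Cmod (RtoC (norm x))).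
    rewrite Cmod_R, Rabs_pos_eq by easy; nra.
  + rewrite (linear_scal _ (bop_linear T)).
    vlin V; unfold c; rewrite Cmult_1_r, <- RtoC_mult; f_equal; field; easy.
Qed.

Lemma opnorm_le (U V : NormedModule C_AbsRing) (T : bounded_op U V) (r : R) :
  0 <= r -> (forall x, norm (T x) <= r * norm x) -> Rbar_le (opnorm T) r.
Proof.
intros Hr HT.
destruct (Lub_Rbar_correct (fun r => exists x : U, norm x <= 1 /\ r = norm (T x))) as [_ Hlub].
apply Hlub; intros s [x [Hx ->]]; simpl.
eapply Rle_trans; [apply HT|].
rewrite <- (Rmult_1_r r) at 2; now apply Rmult_le_compat_l.
Qed.

Section Resolvent.
Variable W : CompleteNormedModule C_AbsRing.
Variable B : operator W W.

Lemma bounded_inverse_unique (z : C) (S T : bounded_op W W) :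
  bounded_inverse (pencil (bop_id W) B z) S -> bounded_inverse (pencil (bop_id W) B z) T ->
  forall w, S w = T w.
Proof.
intros [HS _] [_ HT] w; destruct (HS w) as [Hd E].
now rewrite <- (HT (S w) Hd), E.
Qed.

(** T w lies in the domain, so T w = S ((z - B) T w), and (z - B) T w = (z' - B) T w + (z - z') T w
    = w + (z - z') T w. *)
Lemma first_resolvent_identity (z z' : C) (S T : bounded_op W W) :
  bounded_inverse (pencil (bop_id W) B z) S -> bounded_inverse (pencil (bop_id W) B z') T ->
  forall w, T w = plus (S w) (scal (Cminus z z' : C_AbsRing) (S (T w))).
Proof.
intros [_ HS] [HT _] w; destruct (HT w) as [Hd E].
rewrite <- (HS (T w) Hd) at 1.
rewrite <- (linear_scal _ (bop_linear S)), <- (linear_plus _ (bop_linear S)); f_equal.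
rewrite <- E at 2; simpl; vlin W; ring.
Qed.
End Resolvent.

Section Weierstrass.
Variables X Z Y1 Y2 : HilbertSpace.
Variables (E : bounded_op X Z) (A : operator X Z).
Variables (A1 : operator Y1 Y1) (N : bounded_op Y2 Y2).

Lemma fst_norm_le (u : hilbert_sum Y1 Y2) : norm (fst u) <= norm u.
Proof.
change (norm (fst u) <= sqrt (norm (fst u) ^ 2 + norm (snd u) ^ 2)).
rewrite <- (sqrt_pow2 (norm (fst u))) at 1 by apply norm_ge_0.
apply sqrt_le_1_alt; pose proof (pow2_ge_0 (norm (snd u))); lra.
Qed.

Lemma inl_norm (y : Y1) : norm ((y, zero) : hilbert_sum Y1 Y2) = norm y.
Proof.
change (sqrt (norm y ^ 2 + norm (zero : Y2) ^ 2) = norm y).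
replace (norm (zero : Y2)) with 0 by (symmetry; exact (@norm_zero C_AbsRing Y2)).
replace (norm y ^ 2 + 0 ^ 2) with (norm y ^ 2) by ring.
apply sqrt_pow2, norm_ge_0.
Qed.

(** The equivalence conjugates z E - A to the block diagonal pencil with blocks z - A1 and z N - I,
    so the upper left block of P S Q^{-1} inverts z - A1. The constant M is a product of bounds for
    P and Q^{-1}; it does not depend on z, hence the growth exponent is preserved. *)
Lemma weierstrass_resolvent :
  weierstrass_form E A A1 N ->
  exists M, 0 < M /\ forall (z : C) (S : bounded_op Z X), bounded_inverse (pencil E A z) S ->
    exists T : bounded_op Y1 Y1, bounded_inverse (pencil (bop_id Y1) A1 z) T /\
      forall c, (forall x, norm (S x) <= c * norm x) -> 0 <= c ->
        forall y, norm (T y) <= M * c * norm y.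
Proof.
intros [_ [P [Pinv [Q [Qinv [[HP1 HP2] [[HQ1 HQ2] [HE [HD HA]]]]]]]]].
destruct (linear_norm _ (bop_linear P)) as [MP [HMP HPn]].
destruct (linear_norm _ (bop_linear Qinv)) as [MQ [HMQ HQn]].
exists (MP * MQ); split; [nra|].
intros z S [HS1 HS2].
assert (HT : @is_linear C_AbsRing Y1 Y1 (fun y => fst (P (S (Qinv (y, zero)))))).
{ apply (is_linear_comp (U := Y1) (V := hilbert_sum Y1 Y2) (W := Y1)
    (fun y => P (S (Qinv (y, zero)))) fst).
  - apply (is_linear_comp (fun y => S (Qinv (y, zero))) P); [|apply P].
    apply (is_linear_comp (fun y => Qinv (y, zero)) S); [|apply S].
    apply (is_linear_comp (U := Y1) (V := hilbert_sum Y1 Y2) (fun y => (y, zero)) Qinv); [|apply Qinv].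
    apply (@is_linear_prod C_AbsRing Y1 Y1 Y2 (fun y => y) (fun _ => zero)).
    + apply is_linear_id.
    + apply is_linear_zero.
  - apply (@is_linear_fst C_AbsRing Y1 Y2). }
exists (Build_bounded_op HT).
(* The conjugation identity behind both halves of the inverse property: Q (z E - A) equals the block
   pencil after P on the domain of A. *)
assert (key : forall x, op_dom A x ->
  Q (pencil E A z x) = pencil (diag_bop (bop_id Y1) N) (diag_op A1 (bop_operator (bop_id Y2))) z (P x)).
{ intros x Hx.
  change (Q (minus (scal (z : C_AbsRing) (E x)) (A x)) =
    minus (scal (z : C_AbsRing) (diag_bop (bop_id Y1) N (P x)))
      (diag_op A1 (bop_operator (bop_id Y2)) (P x))).
  rewrite HE, (HA x Hx).
  unfold minus.
  rewrite (linear_plus _ (bop_linear Q)), (linear_opp _ _ (bop_linear Q)),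
    (linear_scal _ (bop_linear Q)), !HQ2; reflexivity. }
repeat split.
- intros; destruct (HS1 (Qinv (z0, zero))) as [Hd _].
  apply HD in Hd; apply Hd.
- destruct (HS1 (Qinv (z0, zero))) as [Hd He].
  pose proof (key _ Hd) as Hk; rewrite He, HQ2 in Hk.
  apply (f_equal fst) in Hk; symmetry; exact Hk.
- intros y Hy.
  set (x := Pinv (y, zero)).
  assert (Hx : op_dom A x).
  { apply HD; unfold x; rewrite HP2; now split. }
  change (fst (P (S (Qinv (pencil (bop_id Y1) A1 z y, zero)))) = y).
  (* The block pencil maps (y, 0) to a vector with second component z N 0 - 0 = 0, so the first
     block can be inverted within vectors of this shape. *)
  replace (Qinv (pencil (bop_id Y1) A1 z y, zero)) with (pencil E A z x).
  + rewrite (HS2 x Hx); unfold x; now rewrite HP2.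
  + rewrite <- (HQ1 (pencil E A z x)), (key x Hx); unfold x; rewrite HP2; f_equal.
    apply injective_projections; [reflexivity|].
    change (minus (scal (z : C_AbsRing) (N zero)) zero = (zero : Y2)).
    rewrite (linear_zero _ (bop_linear N)).
    vlin Y2.
- intros c Hc Hc0 y.
  change (norm (fst (P (S (Qinv (y, zero))))) <= MP * MQ * c * norm y).
  eapply Rle_trans; [apply fst_norm_le|].
  eapply Rle_trans; [apply HPn|].
  rewrite !Rmult_assoc; apply Rmult_le_compat_l; [lra|].
  eapply Rle_trans; [apply Hc|].
  rewrite <- Rmult_assoc, (Rmult_comm MQ), Rmult_assoc.
  apply Rmult_le_compat_l; [easy|].
  eapply Rle_trans; [apply HQn|]; rewrite inl_norm; lra.
Qed.
End Weierstrass.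

(** The quotient keeps natural exponents and stays correct at p = 0, where a truncated p - 1 would
    not. *)
Lemma powerRZ_pred (x : R) (p : nat) : x <> 0 -> powerRZ x (Z.of_nat p - 1) = x ^ p / x.
Proof.
intros Hx; unfold Z.sub; rewrite powerRZ_add, <- pow_powerRZ by easy.
simpl; field; easy.
Qed.

Theorem theorem3p9 (X Z : HilbertSpace) (E : bounded_op X Z) (A : operator X Z)
  (A_closed : closed_operator A) (A_dense : densely_defined A)
  (Y1 Y2 : HilbertSpace) (A1 : operator Y1 Y1) (N : bounded_op Y2 Y2)
  (EA_weierstrass : weierstrass_form E A A1 N)
  (A1_dense : densely_defined A1)
  (p : nat) (EA_index : is_complex_resolvent_index E A p) :
  generates_integrated_semigroup (p + 2)%nat A1.
Proof.
destruct EA_index as [[omega [K0 [HK0 [Hres Hgrowth]]]] _].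
destruct (weierstrass_resolvent EA_weierstrass) as [M [HM Htransfer]].
(* Beyond omega, so that resolvents exist with the growth bound, and at least 1, so that z never
   vanishes and 1/|z| <= 1. *)
set (a := Rmax omega 0 + 1).
assert (Ha1 : 1 <= a) by (unfold a; pose proof (Rmax_r omega 0); lra).
assert (Haw : omega < a) by (unfold a; pose proof (Rmax_l omega 0); lra).
set (K := M * K0).
assert (HK : 0 <= K) by (unfold K; nra).
(* Resolvents are only known to exist point by point, while the line integral needs a function of z.
   Guarding the specification by a <= Re z makes it total, with the identity as a dummy value
   elsewhere. *)
destruct (functional_choice (fun (z : C) (T : bounded_op Y1 Y1) => a <= Re z ->
  bounded_inverse (pencil (bop_id Y1) A1 z) T /\
  forall w, norm (T w) <= K * (Cmod z ^ p / Cmod z) * norm w)) as [Rz HRz].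
{ intros z; destruct (Rle_dec a (Re z)) as [Hz|Hz]; [|exists (bop_id Y1); intros; contradiction].
  destruct (Hres z) as [S HS]; [lra|].
  destruct (Htransfer z S HS) as [T [HT Hb]]; exists T; intros _; split; [easy|].
  pose proof (Cmod_ge_1 Ha1 Hz) as H1.
  intros w; unfold K; rewrite (Rmult_assoc M).
  assert (Hp : 0 < Cmod z ^ p / Cmod z) by (apply Rdiv_lt_0_compat; [apply pow_lt|]; lra).
  apply Hb; [|nra].
  apply opnorm_bound; rewrite <- powerRZ_pred by lra.
  apply Hgrowth; [lra|easy]. }
assert (Hid : forall z z' w, a <= Re z -> a <= Re z' ->
  Rz z' w = plus (Rz z w) (scal (Cminus z z' : C_AbsRing) (Rz z (Rz z' w)))).
{ intros z z' w Hz Hz'; eapply first_resolvent_identity; now apply HRz. }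
assert (Hgr : forall z w, a <= Re z -> norm (Rz z w) <= K * (Cmod z ^ p / Cmod z) * norm w).
{ intros z w Hz; now apply HRz. }
set (b := a + 1).
assert (Hab : a < b) by (unfold b; lra).
(* From K >= 0, the sum K + 1 is a strictly positive constant that still dominates the bound of
   [inverse_laplace_norm]. *)
exists (K + 1), b, (inverse_laplace_bop Ha1 Hab HK Hid Hgr).
split; [lra|]; split; [unfold b; lra|]; split; [|split; [|split]].
- intros w t _.
  (* The integral defines S(t) for every real t and is continuous there, so continuity on the
     half-line, endpoint 0 included, follows by restricting the filter. *)
  refine (filterlim_filter_le_1 _ _ (continuous_inverse_laplace Ha1 Hab HK Hid Hgr (w := w) (t := t))).
  intros Q; unfold within; apply filter_imp; auto.
- intros t _; pose proof (exp_pos (b * t)); apply opnorm_le; [nra|].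
  intros w; eapply Rle_trans; [apply (inverse_laplace_norm Ha1 Hab HK Hid Hgr)|].
  apply Rmult_le_compat_r; [apply norm_ge_0|]; nra.
- intros lam Hlam; exists (Rz (RtoC lam)); apply HRz; simpl; lra.
- intros lam Res Hlam HRes w.
  exists (scal (/ lam ^ (p + 2)) (Rz (RtoC lam) w : realification Y1)); split.
  + apply (is_RInt_gen_inverse_laplace Ha1 Hab HK Hid Hgr (w := w) Hlam).
  + rewrite (bounded_inverse_unique HRes (proj1 (HRz (RtoC lam) ltac:(simpl; lra)))).
    assert (lam ^ (p + 2) <> 0) by (apply pow_nonzero; unfold b in Hlam; lra).
    vlin Y1; apply injective_projections; simpl; field; easy.
Qed.
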